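(* A class of graphs $\mathscr C$ is a transduction of the class of all cubic trees if and only if it is a perturbation of a class with both bounded treewidth and bounded maximum degree.
   Context: Graphs are finite, undirected and loopless; a class of graphs is a set of graphs considered up to isomorphism, and every class contains the empty graph. A cubic tree is a tree in which every internal (non-leaf) vertex has degree $3$. Bounded treewidth (resp. bounded maximum degree) means that a constant bounds the treewidth (resp. maximum degree) of all graphs in the class. For a set $\mathcal U$ of unary relation symbols, a $\mathcal U$-colored graph is a graph with additional unary relations in $\mathcal U$. Formulas are first-order, with adjacency relation $E$. Transductions. For a positive integer $k$, the $k$-copy operation $\mathsf C_k$ maps a graph $G$ to the graph consisting of $k$ copies of $G$ in which the $k$ copies of each vertex are made pairwise adjacent (no other edges between the copies). The coloring operation $\Gamma_{\mathcal U}$ maps a graph to the set of all its $\mathcal U$-expansions. A simple interpretation $\mathsf I=(\nu(x),\eta(x,y))$ of graphs in $\mathcal U$-colored graphs is a pair of first-order formulas with $\eta$ symmetric and anti-reflexive; $\mathsf I(G^+)$ is the graph with vertex set $\nu(G^+)$ and edge set $\eta(G^+)\cap\nu(G^+)^2$. A transduction is a composition $\mathsf T=\mathsf I\circ\Gamma_{\mathcal U}\circ\mathsf C_k$, so $\mathsf T(G)=\{\mathsf I(G^+): G^+\in\Gamma_{\mathcal U}(\mathsf C_k(G))\}$. For a class $\mathscr D$, $\mathsf T(\mathscr D)=\bigcup_{G\in\mathscr D}\mathsf T(G)$ up to isomorphism. A class $\mathscr C$ is a transduction of $\mathscr D$ if $\mathscr C\subseteq\mathsf T(\mathscr D)$ for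 some transduction $\mathsf T$. Perturbations. A subset complementation is the transduction that chooses a subset $M$ of vertices (a unary relation) and complements the adjacency inside $M$. A perturbation is a composition of a bounded number of subset complementations. A class $\mathscr C$ is a perturbation of $\mathscr D$ if $\mathscr C\subseteq\mathsf P(\mathscr D)$ for some perturbation $\mathsf P$. *)

(* Defs.v *)
From mathcomp Require Import all_boot.

Set Implicit Arguments.
Unset Strict Implicit.
Unset Printing Implicit Defensive.

Record sgraph := SGraph {
  vert :> finType;
  adj : rel vert;
  adj_sym : symmetric adj;
  adj_irr : irreflexive adj }.

Arguments adj {s} x y.

Definition iso (G H : sgraph) : Prop :=
  exists2 f : G -> H, bijective f & forall x y, adj (f x) (f y) = adj x y.

Lemma void_adj_sym : symmetric (fun x y : void => false).
Proof. by []. Qed.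

Lemma void_adj_irr : irreflexive (fun x y : void => false).
Proof. by []. Qed.

Definition empty_graph : sgraph := SGraph void_adj_sym void_adj_irr.

Record gclass := GClass {
  in_class :> sgraph -> Prop;
  class_iso : forall G H, iso G H -> in_class G -> in_class H;
  class_empty : in_class empty_graph }.

Definition degree (G : sgraph) (x : G) : nat := #|[set y | adj x y]|.

Definition max_degree (G : sgraph) : nat := \max_(x : G) degree x.

Definition is_connected (G : sgraph) : Prop :=
  0 < #|G| /\ forall x y : G, connect adj x y.

(* [ucycle adj [:: x; y]] holds for every edge xy, hence the bound 3. *)
Definition is_acyclic (G : sgraph) : Prop :=
  forall s : seq G, ucycle adj s -> size s < 3.

Definition is_tree (G : sgraph) : Prop := is_connected G /\ is_acyclic G.

(* The vertex of the one-vertex tree counts as a leaf. *)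
Definition leaf (G : sgraph) (x : G) : bool := degree x <= 1.

Definition cubic_tree (G : sgraph) : Prop :=
  is_tree G /\ forall x : G, ~~ leaf x -> degree x = 3.

Record tree_decomposition (G T : sgraph) (bag : T -> {set G}) : Prop := {
  td_tree : is_tree T;
  td_vertex : forall x : G, exists t, x \in bag t;
  td_edge : forall x y : G, adj x y -> exists t, (x \in bag t) && (y \in bag t);
  (* the nodes whose bag contains x induce a connected subgraph of T *)
  td_conn : forall (x : G) (s t : T), x \in bag s -> x \in bag t ->
    connect (fun u v => [&& adj u v, x \in bag u & x \in bag v]) s t }.

Definition width (G T : sgraph) (bag : T -> {set G}) : nat :=
  (\max_(t : T) #|bag t|).-1.

Definition treewidth_le (G : sgraph) (k : nat) : Prop :=
  exists (T : sgraph) (bag : T -> {set G}),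
    tree_decomposition bag /\ width bag <= k.

Definition bounded_treewidth (D : gclass) : Prop :=
  exists k, forall G, D G -> treewidth_le G k.

Definition bounded_degree (D : gclass) : Prop :=
  exists d, forall G, D G -> max_degree G <= d.

Section IsoInvariance.
Variables (G H : sgraph) (f : G -> H).
Hypothesis fbij : bijective f.
Hypothesis fadj : forall x y, adj (f x) (f y) = adj x y.

Lemma iso_degree x : degree (f x) = degree x.
Proof.
rewrite /degree -(card_imset _ (bij_inj fbij)); apply: eq_card => z.
have [g fK gK] := fbij.
rewrite inE; apply/idP/imsetP => [xz|[y]].
  by exists (g z); rewrite ?gK // inE -fadj gK.
by rewrite inE => xy ->; rewrite fadj.
Qed.

Lemma iso_is_tree : is_tree G -> is_tree H.
Proof.
have [g fK gK] := fbij.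
have gadj x y : adj (g x) (g y) = adj x y by rewrite -fadj !gK.
case=> -[G0 Gc] Ga; split; first split.
- by rewrite -(bij_eq_card fbij).
- move=> x y; have /connectP[p gp lp] := Gc (g x) (g y).
  apply/connectP; exists (map f p); last by rewrite -(gK x) last_map -lp gK.
  rewrite -(gK x) (map_path (e' := adj) (b := pred0)) //.
  by apply/hasPn.
- move=> s /andP[cs us]; rewrite -(size_map g); apply: Ga.
  rewrite /ucycle map_inj_uniq ?us ?andbT; last exact: can_inj gK.
  case: s cs {us} => //= x s; rewrite -map_rcons.
  by rewrite path_map (eq_path (e' := adj)) // => u v /=; rewrite gadj.
Qed.

End IsoInvariance.

Definition empty_or_cubic_tree (G : sgraph) : Prop :=
  iso empty_graph G \/ cubic_tree G.

Lemma iso_trans G H K : iso G H -> iso H K -> iso G K.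
Proof.
case=> f fb fa [g gb ga]; exists (g \o f); first exact: bij_comp.
by move=> x y; rewrite /= ga fa.
Qed.

Lemma iso_refl G : iso G G.
Proof. by exists id => //; exists id. Qed.

Lemma iso_sym G H : iso G H -> iso H G.
Proof.
case=> f [g fK gK] fa; exists g; first by exists f.
by move=> x y; rewrite -fa !gK.
Qed.

Lemma empty_or_cubic_tree_iso G H :
  iso G H -> empty_or_cubic_tree G -> empty_or_cubic_tree H.
Proof.
move=> GH [eG|[Gt Gd]]; [left; exact: iso_trans eG GH|right].
have [f fb fa] := GH; split; first exact: iso_is_tree fb fa Gt.
have [g fK gK] := fb => y; rewrite -(gK y) /leaf (iso_degree fb fa).
exact: Gd.
Qed.

(* Every class contains the empty graph. *)
Definition cubic_trees : gclass :=
  GClass empty_or_cubic_tree_iso (or_introl (iso_refl empty_graph)).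

Record cgraph (U : Type) := CGraph {
  cg :> sgraph;
  color : U -> pred cg }.

Arguments color {U c} u x.

(* [form U n] : formulas with free variables among x_0, ..., x_(n-1), in
   de Bruijn style: [FEx] binds x_0 of its body and shifts the others. *)
Inductive form (U : Type) : nat -> Type :=
  | FEq n of 'I_n & 'I_n : form U n
  | FAdj n of 'I_n & 'I_n : form U n
  | FCol n of U & 'I_n : form U n
  | FNot n of form U n : form U n
  | FAnd n of form U n & form U n : form U n
  | FEx n of form U n.+1 : form U n.

Fixpoint sat (U : Type) (G : cgraph U) n (phi : form U n) :
    n.-tuple G -> bool :=
  match phi in form _ n return n.-tuple G -> bool with
  | FEq _ i j => fun e => tnth e i == tnth e j
  | FAdj _ i j => fun e => adj (tnth e i) (tnth e j)
  | FCol _ u i => fun e => color u (tnth e i)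
  | FNot _ p => fun e => ~~ sat p e
  | FAnd _ p q => fun e => sat p e && sat q e
  | FEx _ p => fun e => [exists v : G, sat p [tuple of v :: e]]
  end.

Record simple_interp (U : Type) := SimpleInterp {
  nu : form U 1;
  eta : form U 2;
  eta_sym : forall (G : cgraph U) (x y : G),
    sat eta [tuple x; y] = sat eta [tuple y; x];
  eta_irr : forall (G : cgraph U) (x : G), ~~ sat eta [tuple x; x] }.

Section Interp.
Variables (U : Type) (I : simple_interp U) (G : cgraph U).

Definition interp_vert : finType := {x : G | sat (nu I) [tuple x]}.

Definition interp_adj : rel interp_vert :=
  fun x y => sat (eta I) [tuple val x; val y].

Lemma interp_adj_sym : symmetric interp_adj.
Proof. by move=> x y; apply: eta_sym. Qed.

Lemma interp_adj_irr : irreflexive interp_adj.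
Proof. by move=> x; apply/negbTE/eta_irr. Qed.

Definition interp : sgraph := SGraph interp_adj_sym interp_adj_irr.

End Interp.

Section Copy.
Variables (k : nat) (G : sgraph).

Definition copy_adj : rel (G * 'I_k)%type := fun x y =>
  (x.2 == y.2) && adj x.1 y.1 || (x.1 == y.1) && (x.2 != y.2).

Lemma copy_adj_sym : symmetric copy_adj.
Proof.
by move=> x y; rewrite /copy_adj adj_sym (eq_sym x.1) (eq_sym x.2).
Qed.

Lemma copy_adj_irr : irreflexive copy_adj.
Proof. by move=> x; rewrite /copy_adj adj_irr !eqxx. Qed.

Definition copy : sgraph := SGraph copy_adj_sym copy_adj_irr.

End Copy.

Record transduction := Transduction {
  tr_colors : Type;
  tr_copies : nat;
  tr_copies_gt0 : 0 < tr_copies;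
  tr_interp : simple_interp tr_colors }.

(* [in_image T G H] : H belongs, up to isomorphism, to T(G). *)
Definition in_image (T : transduction) (G H : sgraph) : Prop :=
  exists c : tr_colors T -> pred (copy (tr_copies T) G),
    iso H (interp (tr_interp T) (CGraph c)).

Definition is_transduction_of (C D : gclass) : Prop :=
  exists T, forall H, C H -> exists2 G, D G & in_image T G H.

Definition sc_nu : form unit 1 := FEq unit ord0 ord0.

(* x_0 <> x_1, and exactly one of E and M holds *)
Definition sc_eta : form unit 2 :=
  let x0 : 'I_2 := ord0 in
  let x1 : 'I_2 := ord_max in
  let E := FAdj unit x0 x1 in
  let M := FAnd (FCol tt x0) (FCol tt x1) in
  FAnd (FNot (FEq unit x0 x1))
       (FNot (FAnd (FNot (FAnd E (FNot M))) (FNot (FAnd (FNot E) M)))).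

Lemma sat_sc_nu (G : cgraph unit) (x : G) : sat sc_nu [tuple x].
Proof. exact: eqxx. Qed.

Lemma sat_sc_eta (G : cgraph unit) (x y : G) :
  sat sc_eta [tuple x; y] =
  (x != y) && (adj x y (+) (color tt x && color tt y)).
Proof.
rewrite /= !(tnth_nth x) /=; congr (_ && _).
by case: adj; case: color; case: color.
Qed.

Lemma sc_eta_sym (G : cgraph unit) (x y : G) :
  sat sc_eta [tuple x; y] = sat sc_eta [tuple y; x].
Proof. by rewrite !sat_sc_eta eq_sym adj_sym [X in _ (+) X]andbC. Qed.

Lemma sc_eta_irr (G : cgraph unit) (x : G) : ~~ sat sc_eta [tuple x; x].
Proof. by rewrite sat_sc_eta eqxx. Qed.

Definition subset_complementation : transduction :=
  Transduction (ltn0Sn 0) (SimpleInterp sc_nu sc_eta_sym sc_eta_irr).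

Section ComplementIn.
Variables (G : sgraph) (M : {set G}).

Definition compl_adj : rel G :=
  fun x y => (x != y) && (adj x y (+) ((x \in M) && (y \in M))).

Lemma compl_adj_sym : symmetric compl_adj.
Proof.
by move=> x y; rewrite /compl_adj eq_sym adj_sym [X in _ (+) X]andbC.
Qed.

Lemma compl_adj_irr : irreflexive compl_adj.
Proof. by move=> x; rewrite /compl_adj eqxx. Qed.

Definition complement_in : sgraph := SGraph compl_adj_sym compl_adj_irr.

End ComplementIn.

Lemma subset_complementationP (G H : sgraph) :
  in_image subset_complementation G H <->
  exists M : {set G}, iso H (complement_in M).
Proof.
pose I := tr_interp subset_complementation.
have key (c : unit -> pred (copy 1 G)) (M : {set G}) :
    (forall x, (x \in M) = c tt (x, ord0)) ->
    iso (interp I (CGraph c)) (complement_in M).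
  move=> Mc.
  pose f (x : interp I (CGraph c)) : complement_in M := (val x).1.
  pose g (x : complement_in M) : interp I (CGraph c) :=
    exist _ ((x, ord0) : CGraph c) (@sat_sc_nu (CGraph c) (x, ord0)).
  exists f.
    exists g => [[[x i] xi]|x] //; apply: val_inj.
    by rewrite /= /f /= (ord1 i).
  move=> [[x i] xi] [[y j] yj].
  transitivity (sat sc_eta [tuple ((x, i) : CGraph c); (y, j)]); last by [].
  rewrite sat_sc_eta /f /= /compl_adj /copy_adj /= !Mc (ord1 i) (ord1 j) /=.
  by rewrite andbF orbF xpair_eqE andbT.
split=> [[c Hc]|[M HM]].
  exists [set x | c tt (x, ord0)]; apply: iso_trans Hc (key _ _ _).
  by move=> x; rewrite inE.
exists (fun _ x => x.1 \in M); apply: iso_trans HM (iso_sym (key _ _ _)).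
by [].
Qed.

(* [perturbs p G H] : H belongs, up to isomorphism, to the image of G under the
   composition of p subset complementations. *)
Fixpoint perturbs (p : nat) (G H : sgraph) : Prop :=
  if p is p'.+1 then
    exists2 G', in_image subset_complementation G G' & perturbs p' G' H
  else iso G H.

Definition is_perturbation_of (C D : gclass) : Prop :=
  exists p, forall H, C H -> exists2 G, D G & perturbs p G H.

(* Main.v *)
(* Forward direction.  Gaifman locality for first-order formulas: whether
   [eta(x, y)] holds for two points that are far apart depends only on the
   isomorphism types of the balls around [x] and [y].  In copies of cubic trees
   there is a bounded number of such types, so up to a bounded number of subset
   complementations only edges between points at bounded distance remain.  The
   graph they form has bounded degree, and the balls of the tree are the bags of
   a tree decomposition of bounded width.

   Backward direction.  Balanced separators, applied recursively, give the
   vertices of a graph of bounded treewidth and degree addresses in the infinite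
   binary tree such that each address is shared by boundedly many vertices and
   adjacent vertices lie on a common branch at bounded distance.  The graph is
   thus a bounded-distance relation on copies of a finite cubic tree, and a
   proper colouring of a power of the tree makes this relation first-order
   definable, together with the sets of a perturbation. *)

Require Import Defs.
From mathcomp Require Import all_boot all_fingroup.

Set Implicit Arguments.
Unset Strict Implicit.
Unset Printing Implicit Defensive.

(** * Balls and locality *)

(** Partial isomorphisms are represented by permutations of the whole vertex set, so that they
    compose and invert as group elements; this lemma supplies the extension. Each new point is
    handled by composing with a transposition that fixes the images already chosen. *)
Lemma perm_extend_seq (T : finType) (s : seq T) (f : T -> T) :
  {in s &, injective f} -> exists p : {perm T}, {in s, p =1 f}.
Proof.
elim: s => [|a s IHs] f_inj; first by exists 1%g.
have [|p pf] := IHs; first by apply: sub_in2 f_inj => x xs; rewrite inE xs orbT.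
have [as_|aNs] := boolP (a \in s).
  by exists p => x; rewrite inE => /predU1P[->|]; apply: pf.
exists (p * tperm (p a) (f a))%g => x; rewrite inE permM => /predU1P[->|xs].
  by rewrite tpermL.
have xa : x != a by apply: contraNneq aNs => <-.
have pax : p a != p x by rewrite (inj_eq perm_inj) eq_sym.
have fax : f a != p x.
  apply: contraNneq xa => fax; apply/eqP/f_inj; rewrite ?inE ?xs ?eqxx ?orbT //.
  by rewrite -pf.
by rewrite tpermD // pf.
Qed.

Lemma perm_extend (T : finType) (A : {set T}) (f : T -> T) :
  {in A &, injective f} -> exists p : {perm T}, {in A, p =1 f}.
Proof.
move=> f_inj; have [|p pf] := @perm_extend_seq T (enum A) f.
  by apply: sub_in2 f_inj => x; rewrite mem_enum.
by exists p => x xA; apply: pf; rewrite mem_enum.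
Qed.

Section Balls.
Variable G : sgraph.
Implicit Types (A B : {set G}) (x y z : G) (r s : nat).

Definition nbhd A : {set G} := A :|: [set z | [exists y in A, adj y z]].

Definition ball r A : {set G} := iter r nbhd A.

Lemma nbhdP A z :
  reflect (z \in A \/ exists2 y, y \in A & adj y z) (z \in nbhd A).
Proof.
rewrite !inE; apply: (iffP orP) => -[zA|]; try by left.
  by case/exists_inP=> y yA yz; right; exists y.
by case=> y yA yz; right; apply/exists_inP; exists y.
Qed.

Lemma nbhdS A B : A \subset B -> nbhd A \subset nbhd B.
Proof.
move/subsetP=> AB; apply/subsetP=> z /nbhdP[/AB zB|[y /AB yB yz]].
  by apply/nbhdP; left.
by apply/nbhdP; right; exists y.
Qed.

Lemma sub_nbhd A : A \subset nbhd A. Proof. exact: subsetUl. Qed.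

Lemma ballS r A B : A \subset B -> ball r A \subset ball r B.
Proof. by move=> AB; elim: r => //= r; apply: nbhdS. Qed.

Lemma ball_ball r s A : ball r (ball s A) = ball (r + s) A.
Proof. by rewrite /ball iterD. Qed.

Lemma sub_ball r A : A \subset ball r A.
Proof. by elim: r => //= r IHr; apply: subset_trans IHr (sub_nbhd _). Qed.

Lemma ball_mono r s A : r <= s -> ball r A \subset ball s A.
Proof. by move=> rs; rewrite -(subnK rs) -ball_ball sub_ball. Qed.

Lemma ball_step r A y z : y \in ball r A -> adj y z -> z \in ball r.+1 A.
Proof. by move=> yA yz; apply/nbhdP; right; exists y. Qed.

Lemma ball1_set r A z : (z \in ball r A) = [exists x in A, z \in ball r [set x]].
Proof.
apply/idP/exists_inP => [|[x xA]]; last first.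
  by apply/subsetP/ballS; rewrite sub1set.
elim: r z => [|r IHr] z /=; first by exists z; rewrite ?inE.
case/nbhdP=> [/IHr[x xA xz]|[y /IHr[x xA xy] yz]]; exists x => //.
  by apply/nbhdP; left.
exact: ball_step xy yz.
Qed.

Lemma ballU r A B : ball r (A :|: B) = ball r A :|: ball r B.
Proof.
apply/setP=> z; rewrite inE; apply/idP/orP.
  rewrite ball1_set => /exists_inP[x]; rewrite inE => /orP[xA|xB] xz.
    by left; rewrite ball1_set; apply/exists_inP; exists x.
  by right; rewrite ball1_set; apply/exists_inP; exists x.
by case; apply/subsetP/ballS; [apply: subsetUl | apply: subsetUr].
Qed.

Lemma ball_trans r s A x z :
  x \in ball r A -> z \in ball s [set x] -> z \in ball (s + r) A.
Proof.
move=> xA xz; rewrite -ball_ball ball1_set; apply/exists_inP; by exists x.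
Qed.

Lemma ball_sym r x y : (y \in ball r [set x]) = (x \in ball r [set y]).
Proof.
suff imp a b : a \in ball r [set b] -> b \in ball r [set a].
  by apply/idP/idP; apply: imp.
elim: r a => [|r IHr] a /=; first by rewrite !inE eq_sym.
case/nbhdP=> [/IHr ba|[c /IHr cb ca]]; first by apply/nbhdP; left.
rewrite -[nbhd _]/(ball r.+1 [set a]) -addn1; apply: (ball_trans _ cb); apply/nbhdP; right.
by exists a; rewrite ?inE // adj_sym.
Qed.

Lemma card_ball d r A :
  (forall x, degree x <= d) -> #|ball r A| <= #|A| * d.+1 ^ r.
Proof.
move=> deg_d; elim: r => [|r IHr] /=; first by rewrite muln1.
apply: leq_trans (_ : #|ball r A| * d.+1 <= _); last first.
  by rewrite expnSr mulnA leq_mul2r IHr.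
have -> : nbhd (ball r A) = \bigcup_(x in ball r A) (x |: [set y | adj x y]).
  apply/setP=> z; apply/nbhdP/bigcupP.
    case=> [zA|[y yA yz]]; first by exists z; rewrite ?inE ?eqxx.
    by exists y; rewrite ?inE ?yz ?orbT.
  case=> y yA; rewrite !inE => /predU1P[->|]; first by left.
  by right; exists y.
rewrite -sum_nat_const.
apply: (big_ind2 (fun (B : {set G}) n => #|B| <= n)); first by rewrite cards0.
  move=> B1 n1 B2 n2 h1 h2.
  by apply: leq_trans (leq_add h1 h2); rewrite cardsU leq_subr.
move=> x _; apply: leq_trans (_ : 1 + degree x <= _); last by rewrite ltnS.
by rewrite cardsU1; case: (_ \notin _); rewrite ?leq_add2r.
Qed.

End Balls.

Section LocalMorphisms.
Variables (G : sgraph) (L : eqType) (lab : G -> L).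
Implicit Types (A C : {set G}) (x y z c : G) (g h p : {perm G}) (r s j : nat).

(* Edges leaving the ball are preserved too, so that [h] maps the ball of
   radius [r.+1] onto the ball of radius [r.+1] around the image. *)
Definition local_iso r A h :=
  forall x, x \in ball r A ->
    lab (h x) = lab x /\ forall y, adj (h x) (h y) = adj x y.

Lemma local_isoS r s A C h :
  ball r A \subset ball s C -> local_iso s C h -> local_iso r A h.
Proof. by move=> /subsetP AC hC x /AC /hC. Qed.

(** Each of the [j] steps starts at a point of the ball of radius [r], where [h] preserves all
    edges; hence the bound [r.+1] on [j]. *)
Lemma imset_ball r A h j :
  local_iso r A h -> j <= r.+1 -> h @: ball j A = ball j (h @: A).
Proof.
move=> hA; elim: j => // j IHj jr /=; rewrite -IHj 1?ltnW //.
have jA x : x \in ball j A -> x \in ball r A.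
  by apply/subsetP/ball_mono; rewrite -ltnS.
apply/setP=> z; rewrite -(permKV h z) (mem_imset _ _ perm_inj).
apply/nbhdP/nbhdP; rewrite (mem_imset _ _ perm_inj).
  case=> [|[y yA yz]]; [by left | right; exists (h y)].
    by rewrite (mem_imset _ _ perm_inj).
  by rewrite (proj2 (hA _ (jA _ yA))).
case=> [|[y /imsetP[u uA ->] uz]]; [by left | right; exists u => //].
by rewrite -(proj2 (hA _ (jA _ uA))).
Qed.

Lemma local_iso_inv r A h :
  local_iso r A h -> local_iso r (h @: A) h^-1%g.
Proof.
move=> hA x; rewrite -(imset_ball hA) // => /imsetP[u uA ->].
have [hlab hadj] := hA _ uA; rewrite permK hlab; split=> // y.
by rewrite -[in RHS](permKV h y) hadj.
Qed.

Lemma local_iso_comp r A h g :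
  local_iso r A h -> local_iso r (h @: A) g -> local_iso r A (h * g)%g.
Proof.
move=> hA gA x xA; have [hlab hadj] := hA _ xA.
have [|glab gadj] := gA (h x).
  by rewrite -(imset_ball hA) // imset_f.
by rewrite permM glab hlab; split=> // y; rewrite permM gadj hadj.
Qed.

(** The only edges that could go wrong lead from the ball to a point [y] outside radius [r.+1]. Such
    an edge would put [p y] into the image of the larger ball, against injectivity of [p]. *)
Lemma local_iso_agree r A h p :
  {in ball r.+1 A, p =1 h} -> local_iso r A h -> local_iso r A p.
Proof.
move=> ph hA x xA; have [hlab hadj] := hA _ xA.
have xA1 : x \in ball r.+1 A by apply/nbhdP; left.
rewrite ph //; split=> // y; have [yA|yNA] := boolP (y \in ball r.+1 A).
  by rewrite ph.
have -> : adj x y = false by apply: contraNF yNA => /(ball_step xA).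
apply: contraNF yNA => hxy.
have: p y \in h @: ball r.+1 A.
  rewrite (imset_ball hA) //; apply: (ball_step _ hxy).
  by rewrite -(imset_ball hA) // imset_f.
case/imsetP=> u uA; rewrite -ph // => /perm_inj -> //.
Qed.

(** Disjointness of the balls on both sides makes the piecewise map injective, hence extendable to a
    permutation. The radius [r.+1] is what [local_iso_agree] needs. *)
Lemma local_iso_glue r A C h g :
    local_iso r A h -> local_iso r C g ->
    [disjoint ball r.+1 A & ball r.+1 C] ->
    [disjoint ball r.+1 (h @: A) & ball r.+1 (g @: C)] ->
  exists p, [/\ local_iso r (A :|: C) p, {in A, p =1 h} & {in C, p =1 g}].
Proof.
move=> hA gC dAC dhg.
pose f x := if x \in ball r.+1 A then h x else g x.
have fh : {in ball r.+1 A, f =1 h} by move=> x xA; rewrite /f xA.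
have fg : {in ball r.+1 C, f =1 g}.
  by move=> x xC; rewrite /f (disjointFl dAC xC).
have cross x y : x \in ball r.+1 A -> y \in ball r.+1 C -> f x <> f y.
  move=> xA yC; rewrite fh // fg // => hxgy.
  have hx : h x \in ball r.+1 (h @: A) by rewrite -(imset_ball hA) // imset_f.
  have := disjointFr dhg hx.
  by rewrite hxgy -(imset_ball gC) // imset_f.
have [|p pf] := @perm_extend _ (ball r.+1 A :|: ball r.+1 C) f.
  move=> x y /setUP[xA|xC] /setUP[yA|yC].
  - by rewrite !fh // => /perm_inj.
  - by case/(cross _ _ xA yC).
  - by move/esym/(cross _ _ yA xC).
  - by rewrite !fg // => /perm_inj.
have ph : {in ball r.+1 A, p =1 h}.
  by move=> x xA; rewrite pf ?fh //; apply/setUP; left.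
have pg : {in ball r.+1 C, p =1 g}.
  by move=> x xC; rewrite pf ?fg //; apply/setUP; right.
exists p; split; last 2 first.
- by move=> x xA; apply: ph; apply: subsetP xA; apply: sub_ball.
- by move=> x xC; apply: pg; apply: subsetP xC; apply: sub_ball.
move=> x; rewrite ballU => /setUP[xA|xC].
  exact: local_iso_agree ph hA x xA.
exact: local_iso_agree pg gC x xC.
Qed.

Lemma ball_disjoint r A c :
  c \notin ball (r + r) A -> [disjoint ball r A & ball r [set c]].
Proof.
move=> cNA; rewrite -setI_eq0; apply/eqP/setP=> z; rewrite !inE.
by apply: contraNF cNA => /andP[zA]; rewrite ball_sym; apply: ball_trans.
Qed.

(* Inside the large ball [h] itself extends; outside it, the points of the
   local type of [c] inside the two large balls are equinumerous, hence so are
   those outside. *)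
Lemma local_iso_extend r A h c :
  local_iso (r + (r.+1 + r.+1)) A h ->
  exists p, local_iso r (c |: A) p /\ {in A, p =1 h}.
Proof.
set s := r.+1 + r.+1 => hA.
have hAr : local_iso r A h by apply: local_isoS hA; apply/ball_mono/leq_addr.
have [cA|cNA] := boolP (c \in ball s A).
  exists h; split=> //; apply: local_isoS hA.
  rewrite ballU subUset (ball_mono _ (leq_addr _ _)) andbT.
  by rewrite -ball_ball ballS ?sub1set.
pose K := [set x | [exists g : {perm G}, (g c == x) &&
  [forall y in ball r [set c], (lab (g y) == lab y) &&
     [forall z, adj (g y) (g z) == adj y z]]]].
have KP x : reflect (exists2 g : {perm G}, g c = x & local_iso r [set c] g) (x \in K).
  rewrite inE; apply: (iffP existsP) => [[g /andP[/eqP gx /forall_inP gc]]|].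
    exists g => // y /gc /andP[/eqP glab /forallP gadj]; split=> // z.
    exact/eqP.
  case=> g gx gc; exists g; rewrite gx eqxx; apply/forall_inP=> y /gc[-> gadj].
  by rewrite eqxx; apply/forallP=> z; rewrite gadj.
(* Otherwise [h^-1] would map all of [K] injectively into the part of [K] inside the ball around
   [A]. By cardinality [K] would lie in that ball, but [c] belongs to [K] and is outside it. *)
have [d dK dNB] : exists2 d, d \in K & d \notin ball s (h @: A).
  apply/exists_inP; apply: contraNT cNA => /exists_inPn KB.
  have cK : c \in K.
    by apply/KP; exists 1%g; [rewrite perm1 | move=> x _; split=> [|y]; rewrite !perm1].
  have sub : h^-1%g @: K \subset K :&: ball s A.
    apply/subsetP=> z /imsetP[x xK ->]; have := KB _ xK; rewrite negbK => xB.
    move: (xB); rewrite -(imset_ball hA); last by rewrite ltnW // ltnS leq_addl.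
    case/imsetP=> u uA xE; rewrite inE xE permK uA andbT.
    case/KP: xK => g gx gc; apply/KP; exists (g * h^-1)%g.
      by rewrite permM gx xE permK.
    apply: local_iso_comp (gc) _; rewrite imset_set1 gx xE -imset_set1.
    apply: local_iso_inv; apply: local_isoS hA.
    by rewrite -ball_ball ballS // sub1set.
  have: K :&: ball s A == K.
    rewrite eqEcard subsetIl /= -(card_imset K (@perm_inj _ h^-1%g)).
    exact: subset_leq_card.
  by move/eqP/setP/(_ c); rewrite in_setI cK.
have [g gc gloc] := KP _ dK.
have [] := local_iso_glue hAr gloc (ball_disjoint cNA).
  by rewrite imset_set1 gc; apply: ball_disjoint.
by move=> p [pAc ph _]; exists p; rewrite setUC.
Qed.

End LocalMorphisms.

(** The type of colours may be infinite; labels record only the finitely many colours that occur in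
    the formula. *)
Fixpoint form_colors (U : Type) n (phi : form U n) : seq U :=
  match phi with
  | FCol _ u _ => [:: u]
  | FNot _ p => form_colors p
  | FAnd _ p q => form_colors p ++ form_colors q
  | FEx _ p => form_colors p
  | _ => [::]
  end.

(** At a quantifier, a witness beyond distance [r.+1 + r.+1] has a ball disjoint from the others,
    and a closer one has its [r]-ball inside the enlarged radius. This is the loss in
    [local_iso_extend]. *)
Fixpoint locality_radius (U : Type) n (phi : form U n) : nat :=
  match phi with
  | FNot _ p => locality_radius p
  | FAnd _ p q => maxn (locality_radius p) (locality_radius q)
  | FEx _ p => let r := locality_radius p in r + (r.+1 + r.+1)
  | _ => 0
  end.

(** Induction on the formula. A quantifier is one back-and-forth move: [local_iso_extend] finds an
    answer to the witness while keeping the old points fixed. *)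
Lemma sat_local (U : Type) (G : cgraph U) (L : eqType) (lab : G -> L)
    n (phi : form U n) (a : n.-tuple G) (h : {perm G}) :
    (forall x y, lab x = lab y ->
       [seq color u x | u <- form_colors phi] =
       [seq color u y | u <- form_colors phi]) ->
    local_iso lab (locality_radius phi) [set x in a] h ->
  sat phi (map_tuple h a) = sat phi a.
Proof.
elim: phi a h => {n} [n i j|n i j|n u i|n p IHp|n p IHp q IHq|n p IHp] a h /= cl hl.
- by rewrite !tnth_map (inj_eq perm_inj).
- by rewrite !tnth_map (proj2 (hl _ _)) // inE mem_tnth.
- have [|lh _] := hl (tnth a i); first by rewrite inE mem_tnth.
  by rewrite tnth_map; case: (cl _ _ lh).
- by rewrite IHp.
- have mono r s : r <= s -> local_iso lab s [set x in a] h -> local_iso lab r [set x in a] h.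
    by move=> rs; apply/local_isoS/ball_mono.
  rewrite IHp ?IHq //.
  + move=> x y /cl /eqP; rewrite !map_cat eqseq_cat ?size_map //.
    by case/andP=> _ /eqP.
  + by apply: mono hl; apply: leq_maxr.
  + move=> x y /cl /eqP; rewrite !map_cat eqseq_cat ?size_map //.
    by case/andP=> /eqP.
  + by apply: mono hl; apply: leq_maxl.
(* Stated for an arbitrary tuple and permutation, so that it serves for both [h] and its inverse. *)
have imp (b : n.-tuple G) (k : {perm G}) (v : G) :
    local_iso lab (locality_radius (FEx p)) [set x in b] k ->
    sat p [tuple of v :: b] -> exists w, sat p [tuple of w :: map_tuple k b].
  move=> kl pv; have [m [ml mk]] := local_iso_extend v kl.
  exists (m v); rewrite -(IHp _ m) // in pv; last by rewrite set_cons.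
  suff -> : [tuple of m v :: map_tuple k b] = map_tuple m [tuple of v :: b] by [].
  apply: val_inj => /=; congr (_ :: _); apply/eq_in_map => x xb.
  by rewrite mk // inE.
apply/existsP/existsP => -[v]; last by move/imp; apply.
move/(imp _ h^-1%g); case; last first.
  move=> w; suff -> : map_tuple h^-1%g (map_tuple h a) = a by exists w.
  by apply: val_inj; rewrite /= -map_comp map_id_in // => x _ /=; rewrite permK.
suff -> : [set x in map_tuple h a] = h @: [set x in a] by apply: local_iso_inv.
apply/setP=> x; rewrite inE; apply/mapP/imsetP.
  by case=> y ya ->; exists y; rewrite // inE.
by case=> y; rewrite inE => ya ->; exists y.
Qed.

(** * Types of balls, perturbations *)

Section BallCodes.
Variables (m : nat) (L : finType).

(** A finite type that does not depend on the graph, so that the number of codes is bounded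
    uniformly. A ball of radius [r.+1] is described through positions in an enumeration: centre,
    size, inner ball, adjacency and labels. *)
Definition ball_code : finType :=
  ('I_m.+1 * 'I_m.+1 * {ffun 'I_m -> bool} * {ffun 'I_m * 'I_m -> bool} *
   {ffun 'I_m -> L})%type.

Variables (G : sgraph) (lab : G -> L) (r : nat).

Definition code_of (x : G) : ball_code :=
  let s := enum (ball r.+1 [set x]) in
  (inord (index x s), inord (size s), [ffun i : 'I_m => nth x s i \in ball r [set x]],
   [ffun ij : 'I_m * 'I_m => adj (nth x s ij.1) (nth x s ij.2)],
   [ffun i : 'I_m => lab (nth x s i)]).

(** Matching the two enumerations position by position gives a bijection of the balls of radius
    [r.+1]. These contain all neighbours of the inner balls, so every relevant edge is recorded in
    the code. *)
Lemma code_of_local_iso x y :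
    (forall z : G, #|ball r.+1 [set z]| <= m) -> code_of x = code_of y ->
  exists2 h : {perm G}, h x = y & local_iso lab r [set x] h.
Proof.
move=> ball_m; rewrite /code_of.
set s := enum _; set t := enum _.
have sm : size s <= m by rewrite -cardE.
have tm : size t <= m by rewrite -cardE.
have xs : x \in s by rewrite mem_enum (subsetP (sub_ball _ _)) ?inE.
have yt : y \in t by rewrite mem_enum (subsetP (sub_ball _ _)) ?inE.
case=> /(congr1 val) /= exy /(congr1 val) /= est eball eadj elab.
rewrite !inordK ?ltnS // in est; move: exy; rewrite !inordK ?ltnS; last first.
- by rewrite (leq_trans (index_size _ _)).
- by rewrite (leq_trans (index_size _ _)).
move=> exy.
have ball_nth i : i < size s ->
    (nth x s i \in ball r [set x]) = (nth y t i \in ball r [set y]).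
  move=> i_s; have im := leq_trans i_s sm.
  by move/ffunP/(_ (Ordinal im)): eball; rewrite !ffunE.
have adj_nth i j : i < size s -> j < size s ->
    adj (nth x s i) (nth x s j) = adj (nth y t i) (nth y t j).
  move=> i_s j_s; have im := leq_trans i_s sm; have jm := leq_trans j_s sm.
  by move/ffunP/(_ (Ordinal im, Ordinal jm)): eadj; rewrite !ffunE.
have lab_nth i : i < size s -> lab (nth x s i) = lab (nth y t i).
  move=> i_s; have im := leq_trans i_s sm.
  by move/ffunP/(_ (Ordinal im)): elab; rewrite !ffunE.
pose f z := nth y t (index z s).
have [|h hf] := @perm_extend_seq _ s f.
  move=> u v us vs /eqP; rewrite /f nth_uniq -?est ?index_mem ?enum_uniq //.
  by move/eqP/(congr1 (nth x s)); rewrite !nth_index.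
have hE i : i < size s -> h (nth x s i) = nth y t i.
  by move=> i_s; rewrite hf ?mem_nth // /f index_uniq ?enum_uniq.
exists h; first by rewrite hf // /f exy nth_index.
move=> u ux; have us : u \in s.
  by rewrite mem_enum; apply/nbhdP; left.
have ui : index u s < size s by rewrite index_mem.
rewrite -(nth_index x us) hE // lab_nth //; split=> // v.
have [vs|vNs] := boolP (v \in s).
  by rewrite -(nth_index x vs) hE ?index_mem // -adj_nth ?index_mem.
have -> : adj (nth x s (index u s)) v = false.
  apply: contraNF vNs; rewrite nth_index // => uv.
  by rewrite mem_enum; apply: ball_step uv.
apply: contraNF vNs => uv; have: h v \in t.
  by rewrite mem_enum; apply: ball_step uv; rewrite -ball_nth // nth_index.
move=> hvt; have hvi : index (h v) t < size s by rewrite est index_mem.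
have /perm_inj <- : h (nth x s (index (h v) t)) = h v.
  by rewrite hE // nth_index.
exact: mem_nth.
Qed.

End BallCodes.

(** Equal codes give one local isomorphism at each point. Both pairs being far apart, the two maps
    glue to a single one, to which [sat_local] applies. *)
Lemma sat_far (U : Type) (G : cgraph U) (L : finType) (lab : G -> L) m
    (phi : form U 2) (x y x' y' : G) :
    let r := locality_radius phi in
    (forall u v, lab u = lab v ->
       [seq color c u | c <- form_colors phi] =
       [seq color c v | c <- form_colors phi]) ->
    (forall z : G, #|ball r.+1 [set z]| <= m) ->
    code_of m lab r x = code_of m lab r x' ->
    code_of m lab r y = code_of m lab r y' ->
    y \notin ball (r.+1 + r.+1) [set x] ->
    y' \notin ball (r.+1 + r.+1) [set x'] ->
  sat phi [tuple x; y] = sat phi [tuple x'; y'].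
Proof.
move=> r lab_col ball_m /(code_of_local_iso ball_m)[h hx hloc].
move=> /(code_of_local_iso ball_m)[g gy gloc] xy xy'.
have [||p [ploc px py]] := local_iso_glue hloc gloc.
- exact: ball_disjoint.
- by rewrite !imset_set1 hx gy; apply: ball_disjoint.
rewrite -(sat_local (a := [tuple x; y]) (h := p) lab_col).
  congr (sat _ _); apply: val_inj; rewrite /= px ?inE // py ?inE //.
  by rewrite hx gy.
apply: local_isoS ploc; apply: ballS; apply/subsetP=> z.
by rewrite !inE.
Qed.

(** A symmetric matrix over the field with two elements is a sum of rank-one matrices given by
    indicator vectors. Unions of two types produce the off-diagonal entries, and single types then
    correct the diagonal. *)
Lemma symmetric_type_sets N (T : finType) (ty : T -> 'I_N) (tau : rel 'I_N) :
    symmetric tau ->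
  exists2 Ms : seq {set T}, size Ms = N * N + N & forall x y,
    \big[addb/false]_(M <- Ms) ((x \in M) && (y \in M)) = tau (ty x) (ty y).
Proof.
move=> tau_sym.
pose P (ij : 'I_N * 'I_N) := (ij.1 < ij.2) && tau ij.1 ij.2.
pose pair_in (ij : 'I_N * 'I_N) a := (a == ij.1) || (a == ij.2).
pose F a b := \big[addb/false]_ij (P ij && (pair_in ij a && pair_in ij b)).
have Fne a b : a != b -> F a b = tau a b.
  wlog ab : a b / a < b.
    move=> IH ab; have [|ba|eab] := ltngtP a b; first by move/IH; apply.
      rewrite tau_sym -IH ?(eq_sym b) //.
      by apply: eq_bigr => ij _; rewrite [pair_in _ _ && _]andbC.
    by move/val_inj: eab ab => ->; rewrite eqxx.
  move=> neq_ab; rewrite /F (bigD1 (a, b)) //= big1 /P /pair_in /=.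
    by rewrite ab !eqxx orbT !andbT addbF.
  case=> i j /= ij_ab; apply: contraNF ij_ab => /andP[/andP[ij _] /andP[]].
  move=> /orP[]/eqP ea /orP[]/eqP eb; subst; rewrite ?eqxx // in neq_ab *.
  by rewrite ltnNge ltnW in ab.
(* The error left on the diagonal by the sets for pairs. *)
pose c a := tau a a (+) F a a.
(* Unwanted sets are replaced by [set0], which makes the number of complementations independent of
   [tau]. *)
exists ([seq if P ij then [set x | pair_in ij (ty x)] else set0
           | ij <- enum {: 'I_N * 'I_N}] ++
        [seq if c i then [set x | ty x == i] else set0 | i <- enum 'I_N]).
  by rewrite size_cat !size_map -!enumT -!cardE card_prod !card_ord.
move=> x y; rewrite big_cat !big_map -!enumT !big_enum /=.
transitivity (F (ty x) (ty y) (+)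
              \big[addb/false]_i [&& c i, ty x == i & ty y == i]).
  congr (_ (+) _); apply: eq_bigr => i _.
    by case: (P i); rewrite !inE.
  by case: (c i); rewrite !inE.
have [->|neq] := eqVneq (ty x) (ty y).
  rewrite (bigD1 (ty y)) //= eqxx big1 => [|i /negPf ni].
    by rewrite !andbT addbF /c addbCA addbb addbF.
  by rewrite eq_sym ni !andbF.
rewrite Fne // big1 ?addbF // => i _; apply: contraNF neq.
by case/and3P=> _ /eqP-> /eqP->.
Qed.

Section Flip.
Variables (G : sgraph) (Ms : seq {set G}).

(** Successive complementations add up modulo 2, so a whole perturbation can be performed at
    once. *)
Definition flip_adj : rel G := fun x y =>
  (x != y) && (adj x y (+) \big[addb/false]_(M <- Ms) ((x \in M) && (y \in M))).

Lemma flip_adj_sym : symmetric flip_adj.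
Proof.
move=> x y; rewrite /flip_adj eq_sym adj_sym; congr (_ && (_ (+) _)).
by apply: eq_bigr => M _; rewrite andbC.
Qed.

Lemma flip_adj_irr : irreflexive flip_adj.
Proof. by move=> x; rewrite /flip_adj eqxx. Qed.

Definition flip : sgraph := SGraph flip_adj_sym flip_adj_irr.

End Flip.

Lemma perturbs_iso p G H H' : iso H H' -> perturbs p G H -> perturbs p G H'.
Proof.
elim: p G => [|p IHp] G HH' /=; first by move=> GH; apply: iso_trans GH HH'.
by case=> G' GG' /(IHp _ HH'); exists G'.
Qed.

Lemma perturbs_flip (G : sgraph) (Ms : seq {set G}) : perturbs (size Ms) G (flip Ms).
Proof.
move: {2}(size Ms) (erefl (size Ms)) => p; elim: p G Ms => [|p IHp] G [|M Ms] //=.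
  move=> _; exists id; first by exists id.
  move=> x y; rewrite /= /flip_adj big_nil addbF.
  by case: eqVneq => [->|//]; rewrite adj_irr.
case=> sMs; exists (complement_in M).
  by apply/subset_complementationP; exists M; apply: iso_refl.
apply: perturbs_iso (IHp (complement_in M) Ms sMs).
exists id; first by exists id.
move=> x y; rewrite /= /flip_adj /= /compl_adj big_cons.
by case: eqVneq => //= _; rewrite addbA.
Qed.

Lemma perturbsP p (G H : sgraph) :
  perturbs p G H ->
  exists2 Ms : seq {set G}, size Ms = p & iso (flip Ms) H.
Proof.
elim: p G => [|p IHp] G /=.
  move=> GH; exists [::] => //; apply: iso_trans GH.
  exact: iso_sym (perturbs_flip [::]).
case=> G' /subset_complementationP[M [f fb fa]] /IHp[Ms <- HMs].
have [g fK gK] := fb.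
exists (M :: [seq f @: N | N : {set G'} <- Ms]); first by rewrite /= size_map.
apply: iso_trans HMs; apply: iso_sym; exists f => // x y.
rewrite /= /flip_adj -fa /= /compl_adj (inj_eq (bij_inj fb)).
case: eqVneq => //= _; rewrite big_cons -addbA; congr (_ (+) (_ (+) _)).
rewrite big_map; apply: eq_bigr => N _.
by rewrite !(mem_imset _ _ (bij_inj fb)).
Qed.

(** * From transductions to perturbations *)

Lemma max_degree_leP (G : sgraph) d :
  reflect (forall x : G, degree x <= d) (max_degree G <= d).
Proof.
by apply: (iffP (bigmax_leqP _ _ _)) => [le x|le x _]; apply: le.
Qed.

Lemma iso_max_degree (G H : sgraph) d :
  iso G H -> max_degree G <= d -> max_degree H <= d.
Proof.
case=> f fb fa /max_degree_leP deg_d; apply/max_degree_leP => y.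
by have [g fK gK] := fb; rewrite -(gK y) (iso_degree fb fa).
Qed.

Lemma iso_treewidth_le (G H : sgraph) k :
  iso G H -> treewidth_le G k -> treewidth_le H k.
Proof.
case=> f [g fK gK] fa [T [bag [[tT tv te tc] tw]]].
have memf y t : (y \in f @: bag t) = (g y \in bag t).
  by rewrite -{1}(gK y) (mem_imset _ _ (can_inj fK)).
exists T, (fun t => f @: bag t); split; last first.
  apply: leq_trans tw; rewrite /width (eq_bigr (fun t => #|bag t|)) // => t _.
  exact: card_imset (can_inj fK).
split=> // [y|x y|y s t].
- by have [t yt] := tv (g y); exists t; rewrite memf.
- rewrite -{1}(gK x) -{1}(gK y) fa => /te[t xyt].
  by exists t; rewrite !memf.
- rewrite !memf => ys yt.
  rewrite (@eq_connect _ _ (fun u v => [&& adj u v, g y \in bag u & g y \in bag v])).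
    exact: tc.
  by move=> u v; rewrite !memf.
Qed.

Lemma iso_empty (G : sgraph) : (G -> False) -> iso empty_graph G.
Proof.
move=> noG; exists (fun x : empty_graph => match x : void with end) => [|[]].
by exists (fun x => match noG x with end) => [[]|x]; case: (noG x).
Qed.

(** Trees are nonempty here, so the empty graph is decomposed over a single node with an empty
    bag. *)
Lemma treewidth_le_empty k : treewidth_le empty_graph k.
Proof.
have sym : symmetric (fun x y : unit => false) by [].
have irr : irreflexive (fun x y : unit => false) by [].
exists (SGraph sym irr), (fun=> set0); split; last first.
  by rewrite /width big1 // => t _; rewrite cards0.
split=> [|[]//|[]//|x s t]; last by rewrite inE.
split; first by split=> [|[] []]; [rewrite card_unit | apply: connect0].
by move=> s /andP[_ /card_uniqP <-]; rewrite (leq_ltn_trans (max_card _)) ?card_unit.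
Qed.

Lemma max_degree_empty d : max_degree empty_graph <= d.
Proof. by apply/max_degree_leP; case. Qed.

Definition tw_degree_class (k d : nat) : gclass :=
  @GClass (fun G => treewidth_le G k /\ max_degree G <= d)
    (fun G H GH GD => conj (iso_treewidth_le GH (proj1 GD))
                           (iso_max_degree GH (proj2 GD)))
    (conj (treewidth_le_empty k) (max_degree_empty d)).

Lemma copy_degree k (G : sgraph) d :
  (forall x : G, degree x <= d) -> forall x : copy k G, degree x <= d + k.
Proof.
move=> deg_d [x i]; apply: leq_trans (_ : degree x + k <= _); last first.
  by rewrite leq_add2r.
have sub : [set y | adj ((x, i) : copy k G) y] \subset
    setX [set y | adj x y] [set i] :|: setX [set x] [set: 'I_k].
  apply/subsetP=> -[y j]; rewrite !inE /= /copy_adj /= => /orP[]/andP[].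
    by rewrite eq_sym => -> ->.
  by rewrite eq_sym => ->; rewrite orbT.
apply: leq_trans (subset_leq_card sub) _; apply: leq_trans (leq_card_setU _ _) _.
by rewrite !cardsX !cards1 muln1 mul1n cardsT card_ord.
Qed.

Lemma ball_copy k (G : sgraph) r (x y : copy k G) :
  y \in ball r [set x] -> y.1 \in ball r [set x.1].
Proof.
elim: r y => [|r IHr] y; first by rewrite !inE => /eqP ->.
case/nbhdP=> [/IHr yx|[z /IHr zx /orP[]/andP[]]]; first by apply/nbhdP; left.
  by move=> _; apply: ball_step.
by move=> /eqP <- _; apply/nbhdP; left.
Qed.

Lemma connect_ball (G : sgraph) (R : nat) (a s : G) : s \in ball R [set a] ->
  connect (fun u v => [&& adj u v, u \in ball R [set a] & v \in ball R [set a]]) a s.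
Proof.
suff main r : r <= R -> s \in ball r [set a] -> connect (fun u v =>
    [&& adj u v, u \in ball R [set a] & v \in ball R [set a]]) a s by apply: main.
elim: r s => [|r IHr] s rR /=; first by rewrite inE => /eqP->; apply: connect0.
case/nbhdP=> [|[y ya ys]]; first by apply: IHr; apply: ltnW.
apply: connect_trans (IHr y (ltnW rR) ya) _; apply: connect1.
rewrite ys (subsetP (ball_mono _ (ltnW rR))) //=.
by rewrite (subsetP (ball_mono _ rR)) // (ball_step ya).
Qed.

(** The bag of [t] consists of the vertices lying over the [R]-ball of [t]. The nodes whose bags
    contain [x] then form the ball around the projection of [f x], which is connected and whose
    centre serves every edge at [x]. *)
Lemma tree_ball_treewidth (k R d : nat) (T N : sgraph) (f : N -> copy k T) :
    is_tree T -> (forall t : T, degree t <= d) -> injective f ->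
    (forall x y, adj x y -> f y \in ball R [set f x]) ->
  treewidth_le N (d.+1 ^ R * k).
Proof.
move=> treeT deg_d f_inj fadj.
exists T, (fun t => [set x | (f x).1 \in ball R [set t]]); split.
  split=> // [x|x y /fadj /ball_copy xy|x s t].
  - by exists (f x).1; rewrite inE (subsetP (sub_ball _ _)) ?inE.
  - by exists (f x).1; rewrite !inE xy (subsetP (sub_ball _ _)) ?inE.
  rewrite !in_set (ball_sym _ s) (ball_sym _ t) => /connect_ball cs /connect_ball ct.
  set e := (X in connect X).
  have eE : e =2 (fun u v => [&& adj u v, u \in ball R [set (f x).1]
      & v \in ball R [set (f x).1]]).
    by move=> u v; rewrite /e !in_set (ball_sym _ u) (ball_sym _ v).
  have e_sym : connect_sym e.
    by apply: sym_connect_sym => u v; rewrite !eE adj_sym; congr (_ && _); rewrite andbC.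
  rewrite -!(eq_connect eE) in cs ct.
  by apply: connect_trans ct; rewrite e_sym.
rewrite /width (leq_trans (leq_pred _)) //; apply/bigmax_leqP => t _.
rewrite -(card_imset _ f_inj).
apply: leq_trans (_ : #|setX (ball R [set t]) [set: 'I_k]| <= _).
  apply/subset_leq_card/subsetP=> y /imsetP[x]; rewrite in_set => xt ->.
  by case: (f x) xt => y1 y2; rewrite in_setX in_setT andbT.
rewrite cardsX cardsT card_ord leq_mul2r; apply/orP; right.
by apply: leq_trans (card_ball _ _ deg_d) _; rewrite cards1 mul1n.
Qed.

Section NearPart.
Variables (V : finType) (B : sgraph) (f : V -> B) (R : nat) (e : rel V).
Hypotheses (e_sym : symmetric e) (e_irr : irreflexive e).

Definition near_adj : rel V := fun x y =>
  [&& x != y, f y \in ball R [set f x] & e x y].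

Lemma near_adj_sym : symmetric near_adj.
Proof. by move=> x y; rewrite /near_adj eq_sym ball_sym e_sym. Qed.

Lemma near_adj_irr : irreflexive near_adj.
Proof. by move=> x; rewrite /near_adj eqxx. Qed.

Definition near : sgraph := SGraph near_adj_sym near_adj_irr.

Lemma near_degree d : injective f -> (forall b : B, degree b <= d) ->
  max_degree near <= d.+1 ^ R.
Proof.
move=> f_inj deg_d; apply/max_degree_leP => x; rewrite /degree.
rewrite -(card_imset _ f_inj).
apply: leq_trans (_ : #|ball R [set f x]| <= _).
  by apply/subset_leq_card/subsetP=> z /imsetP[y]; rewrite inE => /and3P[_ xy _] ->.
by apply: leq_trans (card_ball _ _ deg_d) _; rewrite cards1 mul1n.
Qed.

End NearPart.

Lemma cubic_tree_degree (G : sgraph) (x : G) :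
  empty_or_cubic_tree G -> degree x <= 3.
Proof.
case=> [/iso_sym[f _ _]|[_ deg3]]; first by case: (f x).
by have [/leq_trans->//|/deg3 ->] := boolP (leaf x).
Qed.

Lemma transduction_perturbation (C : gclass) :
  is_transduction_of C cubic_trees -> exists D : gclass,
    [/\ bounded_treewidth D, bounded_degree D & is_perturbation_of C D].
Proof.
case=> -[U k k_gt0 I] /= CI.
pose phi := eta I; pose cs := form_colors phi; pose r := locality_radius phi.
pose L : finType := (size cs).-tuple bool.
(* [m] bounds the balls of radius [r.+1] in the [k]-copy, where degrees are at most [3 + k]; [R] is
   the distance required by [sat_far]. *)
pose m := (3 + k).+1 ^ r.+1; pose R := r.+1 + r.+1.
pose K : finType := ball_code m L; pose N := #|K|.
(* The first bound counts balls in the tree, of degree at most 3, times [k] copies; the second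
   counts balls in the [k]-copy. *)
exists (tw_degree_class (4 ^ R * k) ((3 + k).+1 ^ R)); split.
- by exists (4 ^ R * k) => G [].
- by exists ((3 + k).+1 ^ R) => G [].
exists (N * N + N) => H /CI[G GT [c HI]].
pose A := CGraph c.
have degG (x : G) : degree x <= 3 by apply: cubic_tree_degree.
have degA : forall x : A, degree x <= 3 + k by apply: copy_degree.
pose lab (x : A) : L := map_tuple (fun u => color u x) (in_tuple cs).
pose V := interp I A; pose pi (x : V) : A := val x.
pose ty (x : V) : 'I_N := enum_rank (code_of m lab r (pi x)).
pose far (x y : V) := pi y \notin ball R [set pi x].
have far_sym x y : far x y = far y x by rewrite /far ball_sym.
(* By [sat_far], one adjacent far pair with types [a] and [b] forces all far pairs with these types
   to be adjacent. *)
pose tau a b := [exists x : V, exists y : V,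
  [&& ty x == a, ty y == b, far x y & adj x y]].
have tau_sym : symmetric tau.
  move=> a b; apply/idP/idP => /existsP[x /existsP[y /and4P[xa yb xy exy]]];
  by apply/existsP; exists y; apply/existsP; exists x; rewrite yb xa far_sym xy adj_sym.
have tauE (x y : V) : far x y -> tau (ty x) (ty y) = adj x y.
  move=> xy; apply/idP/idP=> [|exy]; last first.
    by apply/existsP; exists x; apply/existsP; exists y; rewrite !eqxx xy.
  case/existsP=> x' /existsP[y' /and4P[/eqP /enum_rank_inj xx'
    /eqP /enum_rank_inj yy' xy' exy']].
  rewrite -[adj x y]/(sat phi [tuple pi x; pi y]).
  rewrite -(sat_far (lab := lab) (m := m) (x := pi x') (y := pi y')) //.
    by move=> u v /(congr1 val).
  move=> z; apply: leq_trans (card_ball _ _ degA) _; by rewrite cards1 mul1n.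
have [Ms sMs MsE] := symmetric_type_sets ty tau_sym.
(* This relation vanishes on far pairs, so its restriction to near pairs loses nothing, and flipping
   by [Ms] recovers [adj]. *)
pose e (x y : V) := adj x y (+) tau (ty x) (ty y).
have e_sym : symmetric e by move=> x y; rewrite /e adj_sym tau_sym.
pose G' := near pi R e_sym.
exists G'; last first.
  rewrite -sMs; apply: perturbs_iso (perturbs_flip (G := G') Ms).
  apply: iso_trans (iso_sym HI); exists id; first by exists id.
  move=> x y; rewrite /= /flip_adj MsE /= /near_adj.
  have [->|neq] /= := eqVneq x y; first exact: (@adj_irr V).
  have [xy|xy] := boolP (pi y \in ball R [set pi x]); last by rewrite /= tauE.
  by rewrite /e -addbA addbb addbF.
split; last by apply: near_degree => //; apply: val_inj.
case: GT => [|[treeG _]]; last first.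
  apply: (@tree_ball_treewidth k R 3 G G' pi treeG) => //; first exact: val_inj.
  by move=> x y /and3P[].
(* The base graph may also be the empty graph, which is not a tree; then the interpreted graph is
   empty. *)
move/iso_sym=> [f _ _]; apply: iso_treewidth_le (treewidth_le_empty _).
by apply: iso_empty => x; case: (f (val x).1).
Qed.

(** * Balanced separators *)

Lemma connect_step_ind (T : finType) (e : rel T) (P : T -> Prop) w s :
    P w -> (forall x y, connect e w x -> P x -> e x y -> P y) ->
  connect e w s -> P s.
Proof.
move=> Pw Pstep /connectP[p ep ->]; elim/last_ind: p ep => [|p y IHp] //=.
rewrite rcons_path last_rcons => /andP[ep py]; apply: Pstep py; last exact: IHp.
by apply/connectP; exists p.
Qed.

Section Sides.
Variable T : sgraph.
Implicit Types u v w s : T.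

Definition cut u v : rel T := fun x y =>
  adj x y && ~~ ((x == u) && (y == v) || (x == v) && (y == u)).

(** The component of [v] once the edge [uv] is deleted. *)
Definition side u v : {set T} := [set s | connect (cut u v) v s].

Lemma side_self u v : v \in side u v.
Proof. by rewrite inE connect0. Qed.

Lemma side_step u v x y : x \in side u v -> cut u v x y -> y \in side u v.
Proof. by rewrite !inE => vx xy; apply: connect_trans vx (connect1 xy). Qed.

(** A simple path from [v] to [u] avoiding the edge [uv] would close up with that edge to a cycle of
    length at least 3. *)
Lemma side_notin u v : is_acyclic T -> adj u v -> u \notin side u v.
Proof.
move=> acyc uv; rewrite inE; apply/negP=> /connectP[p cp uE].
case: (shortenP cp) uE => {p cp} q cq uq _ uE.
have adjq : path adj v q by apply: sub_path cq => x y /andP[].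
have := acyc (v :: q); rewrite /ucycle /= rcons_path adjq -uE uv => /(_ uq).
case: q cq uE {uq adjq} => [|y [|z q]] //= cq uE.
  by move: uv; rewrite uE adj_irr.
by move: cq; rewrite -uE /cut !eqxx orbT !andbF.
Qed.

(** A path from [w] that avoids the edge [vw] never meets [v], so it also avoids [uv]. The strict
    inclusion drives the induction in [branch_light]. *)
Lemma side_proper u v w : is_acyclic T -> adj u v -> adj v w -> w != u ->
  side v w \proper side u v.
Proof.
move=> acyc uv vw wu; apply/properP; split; last first.
  by exists v; [apply: side_self | apply: side_notin].
apply/subsetP=> s; rewrite [s \in side v w]inE.
apply: (connect_step_ind (P := fun x => x \in side u v)).
  apply: side_step (side_self u v) _; rewrite /cut vw eqxx (negPf wu) andbF orbF /=.
  by apply: contraTN uv => /andP[/eqP <-]; rewrite adj_irr.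
move=> x y wx vx xy; have xv : x != v.
  apply: contraNneq (side_notin acyc vw) => xv.
  by rewrite inE -[X in connect _ _ X]xv.
have yv : y != v.
  apply: contraNneq (side_notin acyc vw) => yv.
  rewrite inE -[X in connect _ _ X]yv; exact: connect_trans wx (connect1 xy).
case/andP: xy => xy _.
by apply: side_step vx _; rewrite /cut xy (negPf xv) (negPf yv) andbF.
Qed.

(** A simple path leaves [v] through some [w] and never returns, so the rest of it avoids the edge
    [vw]. *)
Lemma connect_side (e : rel T) v s : subrel e adj -> connect e v s ->
  s = v \/ exists2 w, e v w & s \in side v w.
Proof.
move=> e_adj /connectP[p ep ->]; case: (shortenP ep) => -[|w q] /=; first by left.
move=> /andP[vw eq] /andP[]; rewrite inE negb_or => /andP[vNw vNq] _ _; right.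
exists w => //; rewrite inE; apply/connectP; exists q => //.
have sub : {in predC1 v &, subrel e (cut v w)}.
  move=> x y; rewrite !inE => /negPf xv /negPf yv /e_adj xy.
  by rewrite /cut xy xv yv andbF.
apply: (sub_in_path sub) => //; rewrite /= eq_sym vNw /=.
by apply/allP=> x xq /=; apply: contraNneq vNq => <-.
Qed.

End Sides.

Definition separation (G : sgraph) (X P : {set G}) : Prop :=
  [disjoint P & X] /\ forall x y, x \in P -> adj x y -> y \in P :|: X.

Section BalancedSeparator.
Variables (G T : sgraph) (bag : T -> {set G}) (n : nat) (S : {set G}).
Hypotheses (td : tree_decomposition bag) (bag_n : forall t, #|bag t| <= n).
Hypothesis S_large : 3 * n <= #|S|.

(** The factor 3 avoids division: [A] is light, with at most a third of [S], when its weight is at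
    most [#|S|]. By [S_large] every bag is light. *)
Let weight (A : {set G}) := 3 * #|S :&: A|.

Let balanced := exists X P : {set G}, [/\ #|X| <= n, separation X P,
  weight P <= 2 * #|S| & weight (~: (P :|: X)) <= 2 * #|S|].

Let branch (v w : T) : {set G} := \bigcup_(s in side v w) bag s.

Let weightS (A B : {set G}) : A \subset B -> weight A <= weight B.
Proof. by move=> AB; rewrite leq_mul2l subset_leq_card ?setIS. Qed.

Let weightU (A B : {set G}) : weight (A :|: B) <= weight A + weight B.
Proof. by rewrite -mulnDr leq_mul2l setIUr leq_card_setU. Qed.

Let branches v (cs : seq T) : {set G} :=
  [set x | (x \notin bag v) && has (fun w => x \in branch v w) cs].

(** If [x] is not in the bag of [v], the connected set of nodes whose bags contain [x] avoids [v]
    and stays on one side; a bag covering an edge at [x] lies on that side too. *)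
Let branches_separation v cs :
  all (adj v) cs -> separation (bag v) (branches v cs).
Proof.
move=> /allP vcs; split.
  apply/pred0P=> x /=; rewrite inE; case: (x \in bag v) => //.
  by rewrite andbF.
move=> x y; rewrite !inE => /andP[xv /hasP[w wcs /bigcupP[s sw xs]]] xy.
case: (boolP (y \in bag v)) => [_|_]; first by rewrite orbT.
rewrite orbF; apply/hasP; exists w => //.
have [t /andP[xt yt]] := td_edge td xy.
apply/bigcupP; exists t => //.
apply: (connect_step_ind (P := fun t => t \in side v w)) (td_conn td xs xt)
  => // a b _ aw /and3P[ab xa xb].
apply: side_step aw _; rewrite /cut ab /=.
have neq_v c : x \in bag c -> c == v = false.
  by move=> xc; apply: contraNF xv => /eqP <-.
by rewrite (neq_v a) ?(neq_v b) // andbF.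
Qed.

(** A piece with more than a third of [S] leaves less than two thirds to its complement. *)
Let balanced_or_light (X P : {set G}) : #|X| <= n -> separation X P ->
  weight P <= 2 * #|S| -> balanced \/ weight P <= #|S|.
Proof.
move=> Xn sepXP P2; have [|P1] := leqP (weight P) #|S|; first by right.
left; exists X, P; split=> //; apply: leq_trans (_ : weight (~: P) <= _).
  by rewrite weightS // setCS subsetUl.
have: weight P + weight (~: P) = 3 * #|S|.
  by rewrite /weight -mulnDr -setDE cardsID.
move=> PE; rewrite -(leq_add2l (weight P)) PE (mulSn 2) leq_add2r.
exact: ltnW.
Qed.

Let bag_small v (A : {set G}) : weight A <= #|S| -> weight (A :|: bag v) <= 2 * #|S|.
Proof.
move=> A1; apply: leq_trans (weightU _ _) _; rewrite mul2n -addnn leq_add //.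
apply: leq_trans S_large; rewrite leq_mul2l /=.
by apply: leq_trans (bag_n v); rewrite subset_leq_card ?subsetIr.
Qed.

(** Branches are added one at a time. Two light pieces together have at most two thirds of [S], so
    their union is again light unless it is already a balanced side. *)
Let branches_light v cs : all (adj v) cs ->
    (forall w, w \in cs -> balanced \/ weight (branch v w :\: bag w) <= #|S|) ->
  balanced \/ weight (branches v cs) <= #|S|.
Proof.
elim: cs => [|w cs IHcs] /=.
  right; suff -> : branches v [::] = set0 by rewrite /weight setI0 cards0.
  by apply/setP=> x; rewrite !inE andbF.
case/andP=> vw vcs light.
have [|bal|light_cs] := IHcs vcs; [|by left|].
  by move=> u ucs; apply: light; rewrite inE ucs orbT.
have [|bal|light_w] := light w; [by rewrite inE eqxx|by left|].
have [|||bal|light1] := @balanced_or_light (bag v) (branches v [:: w]);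
  [exact: bag_n| | |by left|].
- by apply: branches_separation; rewrite /= vw.
- apply: leq_trans (bag_small w light_w); apply: weightS; apply/subsetP=> x.
  by rewrite !inE /= orbF => /andP[_ ->]; rewrite andbT orNb.
apply: balanced_or_light (bag_n v) _ _.
  by apply: branches_separation; rewrite /= vw.
apply: leq_trans (_ : weight (branches v [:: w] :|: branches v cs) <= _).
  by apply: weightS; apply/subsetP=> x; rewrite !inE /= orbF -andb_orr.
by apply: leq_trans (weightU _ _) _; rewrite mul2n -addnn leq_add.
Qed.

(** Induction on the size of [side u v]: outside the bag of [v], this branch is covered by the
    branches at [v] that do not lead back to [u]. *)
Let branch_light u v : adj u v ->
  balanced \/ weight (branch u v :\: bag v) <= #|S|.
Proof.
have [_ acyc] := td_tree td.
move: {2}#|side u v| (leqnn #|side u v|) => N.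
elim: N u v => [|N IHN] u v uvN uv.
  by move: uvN; rewrite leqn0 cards_eq0 => /eqP/setP/(_ v); rewrite side_self inE.
pose cs := [seq w <- enum T | adj v w && (w != u)].
have [||bal|light] := @branches_light v cs; [| |by left|].
- by apply/allP=> w; rewrite mem_filter => /andP[/andP[]].
- move=> w; rewrite mem_filter => /andP[/andP[vw wu] _]; apply: IHN => //.
  rewrite -ltnS; apply: leq_trans uvN; exact/proper_card/side_proper.
right; apply: leq_trans light; apply: weightS; apply/subsetP=> x.
rewrite !inE => /andP[xv /bigcupP[s suv xs]]; rewrite xv /=.
have [||sv|[w vw sw]] := @connect_side T (cut u v) v s.
- by move=> a b /andP[].
- by rewrite inE in suv.
- by move: xv; rewrite -sv xs.
apply/hasP; exists w; last by apply/bigcupP; exists s.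
case/andP: vw => vw; rewrite mem_filter mem_enum vw eqxx /= andbT.
by apply: contra => ->; rewrite orbT.
Qed.

Lemma balanced_separator : exists X P : {set G}, [/\ #|X| <= n, separation X P,
  3 * #|S :&: P| <= 2 * #|S| & 3 * #|S :&: ~: (P :|: X)| <= 2 * #|S|].
Proof.
have [[/card_gt0P[v _] conn] _] := td_tree td.
have [||bal|light] := @branches_light v [seq w <- enum T | adj v w]; [| |exact: bal|].
- by apply/allP=> w; rewrite mem_filter => /andP[].
- by move=> w; rewrite mem_filter => /andP[vw _]; apply: branch_light.
(* If no balanced separation has appeared, everything outside the bag of [v] is light, and this bag
   with an empty side is balanced. *)
exists (bag v), set0; split; rewrite ?setI0 ?cards0 ?muln0 //.
  by split=> [|x y]; rewrite ?inE // disjoint_sym disjoints_subset setC0 subsetT.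
rewrite set0U; apply: leq_trans (leq_trans light _); last by rewrite leq_pmull.
apply: weightS; apply/subsetP=> x; rewrite !inE => xv; rewrite xv /=.
have [t xt] := td_vertex td x.
have [tv|[w vw tw]] := connect_side (fun _ _ => id) (conn v t).
  by rewrite -tv xt in xv.
apply/hasP; exists w; last by apply/bigcupP; exists t.
by rewrite mem_filter mem_enum vw.
Qed.

End BalancedSeparator.

(** * Addresses in the binary tree *)

(** An address is read from the node up to the root, so suffixes are ancestors: one address is an
    ancestor of the other at distance at most [r]. *)
Definition close_suffix (r : nat) (a b : seq bool) : Prop :=
  exists2 v, size v <= r & a = v ++ b \/ b = v ++ a.

Lemma close_suffix_sym r a b : close_suffix r a b -> close_suffix r b a.
Proof. by case=> v vr ab; exists v => //; case: ab => ->; [right | left]. Qed.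

Lemma close_suffix_nil r a : size a <= r -> close_suffix r a [::].
Proof. by move=> ar; exists a => //; left; rewrite cats0. Qed.

Lemma close_suffix_rcons r a b c :
  close_suffix r a b -> close_suffix r (rcons a c) (rcons b c).
Proof.
by case=> v vr ab; exists v => //; case: ab => ->; rewrite rcons_cat; [left | right].
Qed.

Section Addresses.
Variables (G T : sgraph) (bag : T -> {set G}) (n d : nat).
Hypotheses (td : tree_decomposition bag) (bag_n : forall t, #|bag t| <= n).
Hypotheses (deg_d : forall x : G, degree x <= d) (n_gt0 : 0 < n).

(** [q] is three times the bound on the closed neighbourhood of a bag; [b] bounds the closed
    neighbourhood of a set of size [q]. *)
Let q := 3 * n * d.+1.
Let b := q * d.+1.

(* [S] contains all vertices of [W] with neighbours outside [W]; it must be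
   placed close to the root, i.e., get short addresses. *)
Let addressing (W S : {set G}) (f : G -> seq bool) : Prop :=
  [/\ forall x y, x \in W -> y \in W -> adj x y -> close_suffix b.+1 (f x) (f y),
      forall x, x \in S -> size (f x) <= #|S|
    & forall w, #|[set x in W | f x == w]| <= q].

(** The separator [X] is put at the root, and the last bit distinguishes the two sides. Neighbours
    of [X] join the new boundary sets, which keeps their addresses short; boundary sets that shrink
    strictly pay for the extra bit. *)
Let addressing_step (W S X P : {set G}) f0 f1 :
    separation X P -> #|X| <= q ->
    let W0 := W :&: P in let W1 := W :&: ~: (P :|: X) in
    let S0 := W0 :&: (S :|: nbhd X) in let S1 := W1 :&: (S :|: nbhd X) in
    addressing W0 S0 f0 -> addressing W1 S1 f1 -> #|S0| <= b -> #|S1| <= b ->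
    S \subset X \/ #|S0| < #|S| /\ #|S1| < #|S| -> S \subset W ->
  exists f, addressing W S f.
Proof.
move=> [PX sepP] Xq W0 W1 S0 S1 [adj0 root0 fib0] [adj1 root1 fib1] S0b S1b SX SW.
pose f x := if x \in X then [::] else
  if x \in P then rcons (f0 x) true else rcons (f1 x) false.
have fX x : x \in X -> f x = [::] by rewrite /f => ->.
have root x : x \in W -> x \in nbhd X -> size (f x) <= b.+1.
  move=> xW xX; rewrite /f; case: ifPn => // xNX; case: ifPn => xP; rewrite size_rcons ltnS.
    by apply: leq_trans S0b; apply: root0; rewrite !in_setI xW xP (in_setU _ S) xX orbT.
  apply: leq_trans S1b; apply: root1.
  by rewrite !in_setI xW in_setC (in_setU _ P) (in_setU _ S) xX orbT
    (negPf xP) (negPf xNX).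
exists f; split=> [x y xW yW xy|x xS|w].
- have [xX|xNX] := boolP (x \in X).
    rewrite (fX x xX); apply/close_suffix_sym/close_suffix_nil/root => //.
    by apply/nbhdP; right; exists x.
  have [yX|yNX] := boolP (y \in X).
    rewrite (fX y yX); apply/close_suffix_nil/root => //.
    by apply/nbhdP; right; exists y; rewrite // adj_sym.
  rewrite /f (negPf xNX) (negPf yNX).
  have [xP|xNP] := boolP (x \in P).
    have := sepP _ _ xP xy; rewrite in_setU (negPf yNX) orbF => yP.
    by rewrite yP; apply: close_suffix_rcons; apply: adj0; rewrite ?in_setI ?xW ?yW.
  have [yP|yNP] := boolP (y \in P).
    have: x \in P :|: X by apply: sepP yP _; rewrite adj_sym.
    by rewrite in_setU (negPf xNP) (negPf xNX).
  apply: close_suffix_rcons; apply: adj1;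
  by rewrite // in_setI in_setC in_setU ?xW ?yW negb_or ?xNP ?yNP.
- have xW := subsetP SW x xS; rewrite /f; case: ifPn => // xNX.
  case: SX => [/subsetP/(_ x xS)|[S0S S1S]]; first by rewrite (negPf xNX).
  case: ifPn => xP; rewrite size_rcons.
    by apply: leq_ltn_trans S0S; apply: root0; rewrite !in_setI xW xP (in_setU _ S) xS.
  apply: leq_ltn_trans S1S; apply: root1.
  by rewrite !in_setI xW in_setC (in_setU _ P) (in_setU _ S) xS (negPf xP) (negPf xNX).
- case/lastP: w => [|w c].
    apply: leq_trans Xq; apply: subset_leq_card; apply/subsetP=> x.
    rewrite inE /f => /andP[_]; case: ifP => //.
    by case: ifP => _ _ /eqP/(congr1 size); rewrite size_rcons.
  apply: leq_trans (if c as c0 return (#|if c0 then [set x in W0 | f0 x == w]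
    else [set x in W1 | f1 x == w]| <= q) then fib0 w else fib1 w).
  apply/subset_leq_card/subsetP=> x; rewrite inE /f => /andP[xW].
  case: ifPn => [_ /eqP/(congr1 size)|xNX]; first by rewrite size_rcons.
  case: ifPn => xP /eqP/rcons_inj[<- <-]; rewrite inE in_setI xW ?xP ?eqxx //.
  by rewrite in_setC in_setU (negPf xP) (negPf xNX).
Qed.

(** If [S] has at most [q] points, it goes entirely to the root: [W] shrinks while the boundary may
    grow up to [b], hence the weight [b.+1]. Otherwise a separator balanced for [S] leaves each side
    two thirds of [S] plus fewer than a third in new neighbours, so the boundary shrinks. *)
Let addressing_exists N (W S : {set G}) : S \subset W -> #|S| <= b ->
  #|W| * b.+1 + #|S| < N -> exists f, addressing W S f.
Proof.
elim: N W S => // N IHN W S SW Sb WSN.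
have q_gt0 : 0 < q by rewrite !muln_gt0 n_gt0.
have card_nbhd (X : {set G}) : #|nbhd X| <= #|X| * d.+1.
  by rewrite -[d.+1]expn1; apply: (@card_ball G d 1 X).
have qb : q <= b by rewrite leq_pmulr.
have [W0|[z zW]] := set_0Vmem W.
  exists (fun=> [::]); split=> [x y|x|w]; first by rewrite W0 inE.
    by rewrite (leq_trans _ (leq0n _)).
  by rewrite (_ : [set _ in _ | _] = set0) ?cards0 //; apply/setP=> x; rewrite W0 !inE.
have [Sq|qS] := leqP #|S| q.
  (* With an empty boundary, an arbitrary vertex is placed at the root to make [W] shrink. *)
  pose X := if S == set0 then [set z] else S.
  have XW : X \subset W by rewrite /X; case: ifP; rewrite ?sub1set.
  have SX : S \subset X by rewrite /X; case: ifP => // /eqP->; apply: sub0set.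
  have Xq : #|X| <= q by rewrite /X; case: ifP; rewrite ?cards1.
  have X_gt0 : 0 < #|X|.
    by rewrite /X; case: ifPn; rewrite ?cards1 // card_gt0.
  (* All remaining vertices go to one side; the other is empty. *)
  have sep : separation X (~: X).
    by split=> [|x y _ _]; [rewrite disjoints_subset | rewrite setUC setUCr inE].
  have Xb : #|S :|: nbhd X| <= b.
    rewrite (setUidPr (subset_trans SX (sub_nbhd _))).
    by apply: leq_trans (card_nbhd X) _; rewrite leq_mul2r Xq orbT.
  have small (W' : {set G}) : W' \subset W :&: ~: X ->
      #|W' :&: (S :|: nbhd X)| <= b /\
      #|W'| * b.+1 + #|W' :&: (S :|: nbhd X)| < N.
    move=> W'W; have S'b : #|W' :&: (S :|: nbhd X)| <= b.
      by apply: leq_trans Xb; apply/subset_leq_card/subsetIr.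
    split=> //; rewrite -ltnS; apply: leq_trans WSN; rewrite ltnS.
    apply: leq_trans (leq_addr _ _).
    have: #|W'| < #|W|.
      apply: leq_ltn_trans (subset_leq_card W'W) _; rewrite -(cardsID X W).
      by rewrite setDE -[ltnLHS]add0n ltn_add2r (setIidPr XW).
    by move=> W'lt; rewrite (leq_trans _ (leq_mul W'lt (leqnn _))) // mulSn addnC ltn_add2r.
  have [|S0b N0] := small (W :&: ~: X); first by [].
  have [|S1b N1] := small (W :&: ~: (~: X :|: X)).
    by apply: setIS; rewrite setCS subsetUr.
  have [f0 f0P] := IHN _ _ (subsetIl _ _) S0b N0.
  have [f1 f1P] := IHN _ _ (subsetIl _ _) S1b N1.
  exact: addressing_step sep Xq f0P f1P S0b S1b (or_introl SX) SW.
have [|X [P [Xn sep S0 S1]]] := @balanced_separator G T bag n S td bag_n.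
  by apply: leq_trans (ltnW qS); rewrite leq_pmulr.
have nX : 3 * #|nbhd X| <= q.
  by rewrite /q -mulnA leq_mul2l; apply: leq_trans (card_nbhd X) _;
    rewrite leq_mul2r Xn orbT.
have small (W' Q : {set G}) : W' \subset W -> W' \subset Q ->
    3 * #|S :&: Q| <= 2 * #|S| ->
    [/\ #|W' :&: (S :|: nbhd X)| < #|S|, #|W' :&: (S :|: nbhd X)| <= b
      & #|W'| * b.+1 + #|W' :&: (S :|: nbhd X)| < N].
  move=> W'W W'Q SQ; have lt : #|W' :&: (S :|: nbhd X)| < #|S|.
    rewrite -(ltn_pmul2l (isT : 0 < 3)).
    apply: leq_ltn_trans (_ : 3 * #|S :&: Q| + 3 * #|nbhd X| < _).
      rewrite -mulnDr leq_mul2l /=; apply: leq_trans (leq_card_setU _ _).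
      rewrite subset_leq_card // setIUr setUSS ?subsetIr //.
      by rewrite setIC setIS.
    by rewrite (mulSn 2) addnC -addSn leq_add // (leq_ltn_trans nX).
  split=> //; first by apply: leq_trans (ltnW lt) _.
  rewrite -ltnS; apply: leq_trans WSN; rewrite ltnS -addnS leq_add //.
  by rewrite leq_mul2r subset_leq_card.
have [||S0S S0b N0] := small (W :&: P) P _ _ S0; rewrite ?subsetIl ?subsetIr //.
have [||S1S S1b N1] := small (W :&: ~: (P :|: X)) _ _ _ S1; rewrite ?subsetIl ?subsetIr //.
have [f0 f0P] := IHN _ _ (subsetIl _ _) S0b N0.
have [f1 f1P] := IHN _ _ (subsetIl _ _) S1b N1.
have Xq : #|X| <= q.
  apply: leq_trans nX; rewrite (leq_trans (subset_leq_card (sub_nbhd X))) //.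
  by rewrite leq_pmull.
exact: addressing_step sep Xq f0P f1P S0b S1b (or_intror (conj S0S S1S)) SW.
Qed.

Lemma bounded_addresses : exists2 f : G -> seq bool,
    forall x y, adj x y -> close_suffix (3 * n * d.+1 * d.+1).+1 (f x) (f y)
  & forall w, #|[set x | f x == w]| <= 3 * n * d.+1.
Proof.
have [|f [fadj _ fib]] := addressing_exists (sub0set [set: G]) _ (leqnn _).
  by rewrite cards0.
exists f => [x y|w]; first by apply: fadj; rewrite inE.
by apply: leq_trans (fib w); rewrite subset_leq_card //; apply/subsetP=> x; rewrite !inE.
Qed.

End Addresses.

(** * Heap-numbered cubic trees *)

Section HeapTree.
Variable n : nat.
Implicit Types i j : 'I_(2 ^ n.+1).

(* Heap numbering: node [i] has parent [i./2] and children [i.*2] and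
   [i.*2.+1], except that [0] is a leaf hanging from the root [1]. *)
Definition heap_adj : rel 'I_(2 ^ n.+1) := fun i j =>
  (i != j) && ((i./2 == j :> nat) || (j./2 == i :> nat)).

Lemma heap_adj_sym : symmetric heap_adj.
Proof. by move=> i j; rewrite /heap_adj eq_sym orbC. Qed.

Lemma heap_adj_irr : irreflexive heap_adj.
Proof. by move=> i; rewrite /heap_adj eqxx. Qed.

Definition heap_tree : sgraph := SGraph heap_adj_sym heap_adj_irr.

Lemma half_lt_pow m k : m < 2 ^ k.+1 -> m./2 < 2 ^ k.
Proof. by move=> mk; rewrite ltn_half_double -mul2n -expnS. Qed.

Lemma half_ord i : i./2 < 2 ^ n.+1.
Proof. by apply: leq_ltn_trans (ltn_ord i); rewrite -divn2 leq_div. Qed.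

Lemma heap_connected : is_connected heap_tree.
Proof.
have h0 : 0 < 2 ^ n.+1 by rewrite expn_gt0.
have to0 (i : heap_tree) : connect adj i (Ordinal h0 : heap_tree).
  move: {2}(i : nat) (leqnn i) => m; elim: m i => [|m IHm] i im.
    suff -> : i = Ordinal h0 by apply: connect0.
    by apply: val_inj; apply/eqP; rewrite -leqn0.
  have [i0|i_gt0] := posnP i; first by apply: IHm; rewrite i0.
  have half_lt : i./2 < i by rewrite ltn_half_double -addnn -{1}[i : nat]addn0 ltn_add2l.
  apply: connect_trans (IHm (Ordinal (half_ord i)) _);
    last by rewrite -ltnS (leq_trans half_lt).
  by apply: connect1; rewrite /= /heap_adj /= eqxx -val_eqE /= gtn_eqF.
split; first by rewrite card_ord.
move=> i j; apply: connect_trans (to0 i) _.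
by rewrite (sym_connect_sym heap_adj_sym).
Qed.

(* Both neighbours of the maximum of a cycle would be its parent. *)
Lemma heap_acyclic : is_acyclic heap_tree.
Proof.
move=> s /andP[cyc_s uniq_s]; case: s cyc_s uniq_s => // x0 s0.
set s := x0 :: s0 => cyc_s uniq_s.
pose x := [arg max_(i > x0 | i \in s) (i : nat)].
have [xs x_max] : x \in s /\ forall y, y \in s -> (y : nat) <= x.
  by rewrite /x; case: arg_maxnP => [|y ys ymax]; [rewrite inE eqxx | split].
have parent y : y \in s -> adj x y -> y = x./2 :> nat.
  move=> ys; rewrite /= /heap_adj => /andP[neq /orP[/eqP->//|/eqP yx]].
  have := x_max y ys; rewrite -yx leqNgt => /negP[].
  rewrite ltn_half_double -addnn -{1}[y : nat]addn0 ltn_add2l lt0n.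
  apply: contraNneq neq => y0; rewrite -val_eqE /=.
  by rewrite y0 /= in yx; rewrite -yx y0.
have /rot_to [k q sE] := xs.
have size_q : size s = (size q).+1 by rewrite -(size_rot k) sE.
rewrite size_q ltnS leqNgt; apply/negP=> q_gt1.
have q_s y : y \in q -> y \in s.
  by move=> yq; rewrite -(mem_rot k) sE inE yq orbT.
have: path.cycle adj (x :: q) by rewrite -sE rot_cycle.
have: uniq (x :: q) by rewrite -sE rot_uniq.
case: q q_gt1 q_s {size_q sE} => [//|y q]; case/lastP: q => [//|q z] _ q_s.
rewrite /= rcons_path last_rcons => /and3P[_ yNq _] /and3P[xy _ zx].
have yE := parent y (q_s _ (mem_head _ _)) xy.
have zq : z \in y :: rcons q z by rewrite inE mem_rcons inE eqxx orbT.
have zE : z = x./2 :> nat by apply: parent (q_s _ zq) _; rewrite adj_sym.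
by case/negP: yNq; rewrite mem_rcons inE -val_eqE /= yE zE eqxx.
Qed.

Lemma heap_cubic : cubic_tree heap_tree.
Proof.
split; first by split; [apply: heap_connected | apply: heap_acyclic].
move=> i; rewrite /leaf -ltnNge => deg_gt1.
(* Nodes from [2 ^ n] on have no children, only their parent as a neighbour. *)
have lt_half : i < 2 ^ n.
  rewrite ltnNge; apply/negP=> ige; move: deg_gt1; rewrite ltnNge; case/negP.
  apply: leq_trans (_ : #|[set (Ordinal (half_ord i) : heap_tree)]| <= 1);
    last by rewrite cards1.
  apply/subset_leq_card/subsetP=> j; rewrite !inE /= /heap_adj => /andP[neq].
  case/orP=> [/eqP ij|/eqP ji]; first by rewrite -val_eqE /= ij.
  have := leq_trans ige (eq_leq (esym ji)).
  by rewrite leqNgt half_lt_pow.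
have double_lt c : (c <= 1) -> c + i.*2 < 2 ^ n.+1.
  move=> c1; apply: leq_trans (_ : i.+1.*2 <= _).
    by rewrite doubleS !ltnS -[leqRHS]add1n leq_add2r.
  by rewrite [leqRHS]expnS mul2n leq_double.
have i_gt0 : 0 < i.
  rewrite lt0n; apply: contraTneq deg_gt1 => i0; rewrite -leqNgt.
  have h1 : 1 < 2 ^ n.+1 by have := double_lt 1 isT; rewrite i0.
  apply: leq_trans (_ : #|[set (Ordinal h1 : heap_tree)]| <= 1);
    last by rewrite cards1.
  apply/subset_leq_card/subsetP=> j; rewrite !inE /= /heap_adj -!val_eqE /= i0.
  by case: (j : nat) => [|[|m]].
pose c0 : heap_tree := Ordinal (double_lt 0 isT).
pose c1 : heap_tree := Ordinal (double_lt 1 isT).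
pose p : heap_tree := Ordinal (half_ord i).
have p_lt : i./2 < i by rewrite ltn_half_double -addnn -{1}[i : nat]addn0 ltn_add2l.
have lt_c0 : i < i.*2 by rewrite -addnn -{1}[i : nat]addn0 ltn_add2l.
suff -> : degree i = #|[set p; c0; c1]|.
  rewrite -setUA cardsU1 cards2 !inE -!val_eqE /= add0n add1n.
  have p_c0 := ltn_trans p_lt lt_c0.
  by rewrite !ltn_eqF // ltnS ltnW.
rewrite /degree; apply: eq_card => j; rewrite !inE /= /heap_adj -!val_eqE /= add0n add1n.
rewrite -orbA [j == i./2 :> nat]eq_sym.
have -> : (j./2 == i) = (j == i.*2 :> nat) || (j == i.*2.+1 :> nat).
  apply/eqP/orP=> [ji|[]/eqP->]; [|by rewrite doubleK|by rewrite /= uphalf_double].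
  rewrite -(odd_double_half j) ji; case: (odd j); [right | left]; exact/eqP.
case: eqVneq => //= <-; rewrite (ltn_eqF p_lt) (ltn_eqF lt_c0) ltn_eqF //.
exact: ltnW.
Qed.

(** The empty address is the root 1, and dropping the head bit is passing to the parent, in
    accordance with the orientation of addresses. *)
Definition heap_index (w : seq bool) : nat := foldr (fun (c : bool) m => c + m.*2) 1 w.

Lemma half_heap_index c w : (heap_index (c :: w))./2 = heap_index w.
Proof. by rewrite /= half_bit_double. Qed.

Lemma heap_index_gt0 w : 0 < heap_index w.
Proof. by elim: w => //= c w IHw; rewrite addn_gt0 double_gt0 IHw orbT. Qed.

Lemma heap_index_inj : injective heap_index.
Proof.
elim=> [|c w IHw] [|c' w'] //=.
- have := heap_index_gt0 w'; case: c'; case: (heap_index w') => //= m.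
- have := heap_index_gt0 w; case: c; case: (heap_index w) => //= m.
move=> e; have := congr1 half e; have := congr1 odd e.
by rewrite !half_bit_double !oddD !odd_double !addbF !oddb => -> /IHw ->.
Qed.

Lemma heap_index_lt w : heap_index w < 2 ^ (size w).+1.
Proof.
elim: w => //= c w IHw; rewrite expnS mul2n.
apply: leq_trans (_ : (heap_index w).+1.*2 <= _); last by rewrite leq_double.
by rewrite doubleS !ltnS -[leqRHS]add1n leq_add2r leq_b1.
Qed.

Definition heap_node (w : seq bool) (wn : size w <= n) : heap_tree :=
  Ordinal (leq_trans (heap_index_lt w)
    (leq_pexp2l (isT : 0 < 2) (wn : (size w).+1 <= n.+1))).

Lemma heap_node_ball v w (wn : size w <= n) (vwn : size (v ++ w) <= n) :
  heap_node wn \in ball (size v) [set heap_node vwn].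
Proof.
rewrite ball_sym; elim: v vwn => [|c v IHv] vwn.
  by rewrite inE -val_eqE.
have vn : size (v ++ w) <= n by apply: ltnW.
apply: (ball_step (IHv vn)).
rewrite /= /heap_adj -!val_eqE; apply/andP; split; last first.
  by apply/orP; right; rewrite (half_heap_index c).
rewrite /= eq_sym; apply/eqP=> /(heap_index_inj (x1 := c :: _)).
by move=> /(congr1 size)/eqP; rewrite /= gtn_eqF.
Qed.

End HeapTree.

(** * Embedding into copies of a cubic tree, and greedy colouring *)

Lemma ball_copy_same k (T : sgraph) r (s t : T) (i : 'I_k) :
  s \in ball r [set t] -> ((s, i) : copy k T) \in ball r [set (t, i) : copy k T].
Proof.
elim: r s => [|r IHr] s; first by rewrite !inE => /eqP ->.
case/nbhdP=> [/IHr st|[u /IHr ut us]]; first by apply/nbhdP; left.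
by apply: ball_step ut _; rewrite /= /copy_adj /= eqxx us.
Qed.

Lemma ball_copy_move k (T : sgraph) r (s t : T) (i j : 'I_k) :
  s \in ball r [set t] -> ((s, j) : copy k T) \in ball r.+1 [set (t, i) : copy k T].
Proof.
move/(ball_copy_same i) => st; have [->|ij] := eqVneq j i; first by apply/nbhdP; left.
by apply: ball_step st _; rewrite /= /copy_adj /= eqxx eq_sym ij orbT.
Qed.

Lemma embed_in_cubic_tree (G : sgraph) k d :
    treewidth_le G k -> max_degree G <= d ->
    let q := 3 * k.+1 * d.+1 in let R := (q * d.+1).+2 in
  exists T : sgraph, cubic_tree T /\ exists2 f : G -> copy q T, injective f &
    forall x y, adj x y -> f y \in ball R [set f x].
Proof.
move=> [T0 [bag [td bag_k]]] /max_degree_leP deg_d q R.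
have bag_k1 t : #|bag t| <= k.+1.
  apply: leq_trans (@leq_bigmax _ (fun u => #|bag u|) t) _; move: bag_k; rewrite /width.
  by case: (\max_t _).
have [f fadj fib] := bounded_addresses td bag_k1 deg_d (ltn0Sn k).
pose n := \max_x size (f x).
have fn x : size (f x) <= n by apply: leq_bigmax.
exists (heap_tree n); split; first exact: heap_cubic.
pose fiber x := enum [set y | f y == f x].
have slot_lt x : index x (fiber x) < q.
  apply: leq_trans (fib (f x)); rewrite cardE index_mem mem_enum inE //.
(* The address chooses the node, and the rank among the vertices with that address chooses the copy.
   Changing copy costs one step, which is why [R] exceeds the address distance by one. *)
pose g x : copy q (heap_tree n) := (heap_node (fn x), Ordinal (slot_lt x)).
exists g => [x y [/heap_index_inj fxy]|x y /fadj[v vr fxy]].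
  have -> : fiber y = fiber x by rewrite /fiber fxy.
  move/(congr1 (nth x (fiber x))); rewrite !nth_index ?mem_enum ?inE ?fxy //.
apply: ball_copy_move; rewrite -/q in vr.
have node a b (bv : f a = v ++ f b) :
    heap_node (fn b) \in ball (size v) [set heap_node (fn a)].
  have vbn : size (v ++ f b) <= n by rewrite -bv.
  suff -> : heap_node (fn a) = heap_node vbn by apply: heap_node_ball.
  by apply: val_inj; rewrite /= bv.
apply: (subsetP (ball_mono _ vr)).
by case: fxy => /node //; rewrite ball_sym.
Qed.

Lemma greedy_coloring (T : finType) (e : rel T) m :
    symmetric e -> irreflexive e -> (forall x, #|[set y | e x y]| < m) ->
  exists col : T -> 'I_m, forall x y, e x y -> col x != col y.
Proof.
move=> e_sym e_irr deg_m.
suff main (s : seq T) : uniq s -> exists col : T -> 'I_m,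
    {in s &, forall x y, e x y -> col x != col y}.
  have [col colP] := main _ (enum_uniq T).
  by exists col => x y; apply: colP; rewrite mem_enum.
elim: s => [|x s IHs] /=.
  (* On an empty [T] there may be no colour at all; otherwise a degree below [m] shows that [m] is
     positive. *)
  have [T0|[x _]] := set_0Vmem [set: T].
    suff noT (x : T) : 'I_m by exists noT.
    by exfalso; have := in_setT x; rewrite T0 inE.
  by exists (fun=> Ordinal (leq_ltn_trans (leq0n _) (deg_m x))).
case/andP=> xNs /IHs[col colP].
have [c cN] : exists c, c \notin col @: [set y | e x y].
  apply/existsP; apply: contraLR (deg_m x); rewrite -leqNgt => /existsPn all_c.
  apply: leq_trans (leq_imset_card col _); rewrite -[leqLHS]card_ord.
  by apply/subset_leq_card/subsetP=> c _; have := all_c c; rewrite negbK.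
have cP y : e x y -> c != col y.
  by move=> xy; apply: contraNneq cN => ->; apply: imset_f; rewrite inE.
exists (fun y => if y == x then c else col y) => y z; rewrite !inE.
case: (eqVneq y x) => [->|_] /= ys; case: (eqVneq z x) => [->|_] /= zs.
- by rewrite e_irr.
- exact: cP.
- by rewrite e_sym eq_sym; apply: cP.
- exact: colP.
Qed.

(** * From perturbations to transductions *)

Section Formulas.
Variable U : Type.

Definition FOr n (p q : form U n) : form U n := FNot (FAnd (FNot p) (FNot q)).

Definition FXor n (p q : form U n) : form U n :=
  FOr (FAnd p (FNot q)) (FAnd (FNot p) q).

Lemma sat_FAnd (G : cgraph U) n (p q : form U n) (a : n.-tuple G) :
  sat (FAnd p q) a = sat p a && sat q a.
Proof. by []. Qed.

Lemma sat_FEx (G : cgraph U) n (p : form U n.+1) (a : n.-tuple G) :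
  sat (FEx p) a = [exists v : G, sat p [tuple of v :: a]].
Proof. by []. Qed.

Lemma sat_FOr (G : cgraph U) n (p q : form U n) (a : n.-tuple G) :
  sat (FOr p q) a = sat p a || sat q a.
Proof. by rewrite /= negb_and !negbK. Qed.

Lemma sat_FXor (G : cgraph U) n (p q : form U n) (a : n.-tuple G) :
  sat (FXor p q) a = sat p a (+) sat q a.
Proof. by rewrite sat_FOr /=; case: sat; case: sat. Qed.

Fixpoint near_form n r (i j : 'I_n) : form U n :=
  if r is r'.+1 then
    FEx (FAnd (FOr (FEq U ord0 (lift ord0 i)) (FAdj U (lift ord0 i) ord0))
              (near_form r' ord0 (lift ord0 j)))
  else FEq U i j.

Lemma sat_near_form (G : cgraph U) n r (i j : 'I_n) (a : n.-tuple G) :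
  sat (near_form r i j) a = (tnth a j \in ball r [set tnth a i]).
Proof.
elim: r n i j a => [|r IHr] n i j a; first by rewrite inE eq_sym.
have tnth_lift v (l : 'I_n) : tnth [tuple of v :: a] (lift ord0 l) = tnth a l.
  by rewrite !(tnth_nth v).
have nbhd1 v : sat (FOr (FEq U ord0 (lift ord0 i)) (FAdj U (lift ord0 i) ord0))
    [tuple of v :: a] = (v \in nbhd [set tnth a i]).
  rewrite sat_FOr /= tnth_lift (tnth_nth v) /=.
  apply/orP/nbhdP=> -[].
  - by move/eqP->; left; rewrite inE.
  - by right; exists (tnth a i); rewrite ?inE.
  - by rewrite inE; left.
  - by case=> y; rewrite inE => /eqP-> ?; right.
have -> : ball r.+1 [set tnth a i] = ball r (nbhd [set tnth a i]).
  by rewrite -addn1 -ball_ball.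
rewrite ball1_set -[near_form _ _ _]/(FEx (FAnd _ (near_form r _ _))) sat_FEx.
apply: eq_existsb => v.
by rewrite sat_FAnd nbhd1 IHr tnth_lift (tnth_nth v).
Qed.

Definition FBig n (op : form U n -> form U n -> form U n) (p0 : form U n)
  (I : finType) (F : I -> form U n) : form U n := foldr op p0 (map F (index_enum I)).

Lemma sat_FBig (G : cgraph U) n (op : form U n -> form U n -> form U n) p0
    (bop : bool -> bool -> bool) (I : finType) (F : I -> form U n) (a : n.-tuple G) :
    (forall p q, sat (op p q) a = bop (sat p a) (sat q a)) ->
  sat (FBig op p0 F) a = \big[bop/sat p0 a]_i sat (F i) a.
Proof.
move=> opE; rewrite /FBig; elim: (index_enum I) => [|i s IHs] /=.
  by rewrite big_nil.
by rewrite big_cons opE IHs.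
Qed.

End Formulas.

(* [Own] is a proper colouring of the [2R]-th power of the base graph, so that
   a neighbour is determined by its colour within radius [R]. *)
Inductive decoding_color (m p : nat) : Type :=
  | Present
  | Own of 'I_m
  | Neighbor of 'I_m
  | Flip of 'I_p.

Arguments Present {m p}.
Arguments Own {m p} a.
Arguments Neighbor {m p} a.
Arguments Flip {m p} i.

Section Decoding.
Variables (m p R : nat).

Notation U := (decoding_color m p).
Notation x0 := (ord0 : 'I_2).
Notation x1 := (ord_max : 'I_2).

Definition FFalse : form U 2 := FNot (FEq U x0 x0).

Definition sees_form (i j : 'I_2) : form U 2 :=
  FBig (@FOr U 2) FFalse
    (fun a : 'I_m => FAnd (FCol (Neighbor a) i) (FCol (Own a) j)).

Definition flips_form : form U 2 :=
  FBig (@FXor U 2) FFalse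
    (fun i : 'I_p => FAnd (FCol (Flip i) x0) (FCol (Flip i) x1)).

(** Each endpoint must announce the colour of the other, which makes the formula symmetric in every
    coloured graph and not only in the intended ones. *)
Definition decode_form : form U 2 :=
  FAnd (FNot (FEq U x0 x1))
    (FXor (FAnd (near_form U R x0 x1) (FAnd (sees_form x0 x1) (sees_form x1 x0)))
       flips_form).

Lemma sat_decode_form (G : cgraph U) (x y : G) :
  sat decode_form [tuple x; y] =
  (x != y) && ([&& y \in ball R [set x],
      [exists a, color (Neighbor a) x && color (Own a) y]
    & [exists a, color (Neighbor a) y && color (Own a) x]] (+)
  \big[addb/false]_(i < p) (color (Flip i) x && color (Flip i) y)).
Proof.
have t0 : tnth [tuple x; y] x0 = x by rewrite (tnth_nth x).
have t1 : tnth [tuple x; y] x1 = y by rewrite (tnth_nth x).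
have satF : sat FFalse [tuple x; y] = false by rewrite /= eqxx.
have sees i j : sat (sees_form i j) [tuple x; y] =
    [exists a, color (Neighbor a) (tnth [tuple x; y] i) &&
                color (Own a) (tnth [tuple x; y] j)].
  rewrite (sat_FBig _ _ (bop := orb)) => [|q q']; last exact: sat_FOr.
  by rewrite satF big_orE.
rewrite !sat_FAnd sat_FXor !sat_FAnd !sees sat_near_form /= t0 t1.
congr (_ && (_ (+) _)).
rewrite /flips_form (sat_FBig _ _ (bop := addb)) => [|q q']; last exact: sat_FXor.
by rewrite satF; apply: eq_bigr => i _; rewrite /= t0 t1.
Qed.

Lemma decode_form_sym (G : cgraph U) (x y : G) :
  sat decode_form [tuple x; y] = sat decode_form [tuple y; x].
Proof.
rewrite !sat_decode_form eq_sym ball_sym; congr (_ && (_ (+) _)).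
  by congr (_ && _); rewrite andbC.
by apply: eq_bigr => i _; rewrite andbC.
Qed.

Lemma decode_form_irr (G : cgraph U) (x : G) : ~~ sat decode_form [tuple x; x].
Proof. by rewrite sat_decode_form eqxx. Qed.

Definition decode_interp : simple_interp U :=
  SimpleInterp (FCol Present ord0) decode_form_sym decode_form_irr.

End Decoding.

Lemma decode_flip (G B : sgraph) (f : G -> B) R d (Ms : seq {set G}) :
    injective f -> (forall x y, adj x y -> f y \in ball R [set f x]) ->
    (forall b : B, degree b <= d) ->
    let m := (d.+1 ^ (R + R)).+1 in let p := size Ms in
  exists c : decoding_color m p -> pred B,
    iso (flip Ms) (interp (decode_interp m p R) (CGraph c)).
Proof.
move=> f_inj f_adj deg_d m p.
(* Two points of the [R]-ball around [f x] are within [R + R] of each other, so a proper colouring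
   of [e] separates them. *)
pose e : rel B := fun x y => (x != y) && (y \in ball (R + R) [set x]).
have [||b|col colP] := @greedy_coloring B e m.
- by move=> x y; rewrite /e eq_sym ball_sym.
- by move=> x; rewrite /e eqxx.
- rewrite ltnS; apply: leq_trans (_ : #|ball (R + R) [set b]| <= _).
    by apply/subset_leq_card/subsetP=> y; rewrite inE => /andP[].
  by apply: leq_trans (card_ball _ _ deg_d) _; rewrite cards1 mul1n.
pose c (u : decoding_color m p) : pred B := match u with
  | Present => [pred z | z \in codom f]
  | Own a => [pred z | col z == a]
  | Neighbor a => [pred z | [exists x, (f x == z) &&
                              [exists y, adj x y && (col (f y) == a)]]]
  | Flip i => [pred z | [exists x, (f x == z) && (x \in nth set0 Ms i)]]
  end.
pose A := CGraph c; exists c.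
have presentP (x : G) : sat (nu (decode_interp m p R)) [tuple (f x : A)].
  by rewrite /= (tnth_nth (f x)) /= codom_f.
pose g (x : flip Ms) : interp (decode_interp m p R) A := exist _ (f x : A) (presentP x).
exists g.
  have inv (z : interp (decode_interp m p R) A) : exists x, f x == val z.
    case: z => z /= pz; move: (pz); rewrite (tnth_nth z) /=.
    by case/codomP=> x ->; exists x.
  exists (fun z => xchoose (inv z)) => [x|z].
    by apply: f_inj; apply/eqP; exact: (xchooseP (inv (g x))).
  by apply: val_inj; apply/eqP; exact: (xchooseP (inv z)).
move=> x y; rewrite -[LHS]/(sat (decode_form m p R) [tuple (f x : A); (f y : A)]).
rewrite sat_decode_form -[RHS]/(flip_adj Ms x y) /flip_adj (inj_eq f_inj).
congr (_ && (_ (+) _)).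
  have neighborP u (a : 'I_m) : color (Neighbor a) (f u : A) =
      [exists v, adj u v && (col (f v) == a)].
    apply/existsP/existsP=> [[u' /andP[/eqP/f_inj-> /existsP//]]|uv].
    by exists u; rewrite eqxx; apply/existsP.
  apply/and3P/idP=> [[xy /existsP[a /andP[]]]|xy].
    rewrite neighborP => /existsP[y' /andP[xy' /eqP y'a]] /eqP ya _.
    (* [y'] is the neighbour announced by [x]; it has the colour of [y], and both images lie in the
       [R]-ball around [f x]. *)
    suff /f_inj -> : f y = f y' by [].
    apply/eqP; apply: contraTT isT => neq.
    have : e (f y) (f y').
      by rewrite /e neq; apply: (ball_trans (x := f x)); [rewrite ball_sym | apply: f_adj].
    by move/colP; rewrite ya y'a eqxx.
  split; first exact: f_adj.
    by apply/existsP; exists (col (f y)); rewrite neighborP /= eqxx andbT;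
       apply/existsP; exists y; rewrite xy eqxx.
  by apply/existsP; exists (col (f x)); rewrite neighborP /= eqxx andbT;
     apply/existsP; exists x; rewrite adj_sym xy eqxx.
rewrite (big_nth set0) big_mkord; apply: eq_bigr => i _.
have flipP u : color (Flip i) (f u : A) = (u \in nth set0 Ms i).
  apply/existsP/idP=> [[v /andP[/eqP/f_inj->]]//|uM].
  by exists u; rewrite eqxx.
by rewrite !flipP.
Qed.

Lemma perturbation_transduction (C D : gclass) :
    bounded_treewidth D -> bounded_degree D -> is_perturbation_of C D ->
  is_transduction_of C cubic_trees.
Proof.
case=> k Dk [d Dd] [p CD].
pose q := 3 * k.+1 * d.+1; pose R := (q * d.+1).+2.
have q_gt0 : 0 < q by [].
(* All parameters depend only on [k], [d] and [p], so a single transduction serves every graph of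
   the class; [3 + q] bounds the degree in [q] copies of a cubic tree. *)
pose m := ((3 + q).+1 ^ (R + R)).+1.
exists (Transduction q_gt0 (decode_interp m p R)) => H /CD[G DG /perturbsP[Ms sMs HMs]].
have [T [cubT [f f_inj f_adj]]] := embed_in_cubic_tree (Dk G DG) (Dd G DG).
exists T; first by right.
have degT : forall b : copy q T, degree b <= 3 + q.
  by apply: copy_degree => t; apply: cubic_tree_degree; right.
case: p / sMs {CD}; have [c cP] := decode_flip Ms f_inj f_adj degT.
by exists c; apply: iso_trans (iso_sym HMs) cP.
Qed.

Theorem proposition16p1 (C : gclass) :
  is_transduction_of C cubic_trees <->
  exists D : gclass,
    [/\ bounded_treewidth D, bounded_degree D & is_perturbation_of C D].
Proof.
split; first exact: transduction_perturbation.
by case=> D [Dtw Ddeg CD]; apply: perturbation_transduction Dtw Ddeg CD.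
Qed.
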